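(* Consider any billiard system in the plane $\mathbb{R}^2$ or the flat torus $\mathbb{R}^2/\mathbb{Z}^2$ whose billiard table $D$ is the complement of a union of finitely many open unit disks (scatterers) with disjoint closures; single out one of them and call it scatterer $0$. Let $\alpha\in(-\frac{\pi}{6},\frac{\pi}{6})$. Then for every $\varepsilon>0$ there exists $\delta>0$, depending only on $\varepsilon$, the location of the scatterers and $\alpha$, such that the following holds. Let a periodic billiard orbit be given satisfying: (1) one segment of its trajectory passes, without colliding with scatterer $0$, at distance $R<\delta$ from the boundary of scatterer $0$; (2) there is exactly one collision with the boundary of scatterer $0$ per period, and the angle of incidence $\alpha_0$ of this collision equals $\alpha$ (so $|\alpha_0|<\frac{\pi}{6}$). Then it is possible to perturb the billiard by moving scatterer $0$ a distance of at most $\varepsilon$ (all other scatterers staying fixed), while perturbing the periodic trajectory continuously, so that the periodic orbit becomes singular.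
   Context: A point particle moves in $D$ at unit speed along straight lines and reflects elastically (angle of incidence equals angle of reflection) at the boundary $\partial D$. A trajectory is the path of the particle; a segment of a trajectory is a straight-line portion between two consecutive collision points. The angle of incidence at a collision point is the signed angle in $[-\frac{\pi}{2},\frac{\pi}{2}]$ between the trajectory and the normal to the boundary. A collision is called grazing if its angle of incidence is $\pm\frac{\pi}{2}$ (the trajectory is tangent to the boundary of the scatterer at that point). A periodic orbit is called singular if it contains a grazing collision. ''Moving scatterer $0$ a distance of at most $\varepsilon$ while perturbing the periodic trajectory continuously so that the periodic orbit becomes singular'' means: there is a one-parameter family, $\gamma\in[0,\gamma_*]$, of billiard systems of the same kind, in which the center $C_0(\gamma)$ of scatterer $0$ depends continuously on $\gamma$, $C_0(0)$ is its original position, the distance from $C_0(0)$ to $C_0(\gamma)$ is at most $\varepsilon$, and all other scatterers are independent of $\gamma$; and, for each $\gamma$, a periodic trajectory of the system with parameter $\gamma$, whose successive collision points $Q_0(\gamma),\dots,Q_{N-1}(\gamma)$ depend continuously on $\gamma$ and lie on the same scatterers in the same order, which for $\gamma=0$ is the given trajectory and for $\gamma=\gamma_*$ is singular (some segment is tangent to the boundary of some scatterer). *)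

(* Defs.v *)
From mathcomp Require Import all_boot all_order all_algebra.
From mathcomp Require Import all_classical all_reals all_analysis.

Set Implicit Arguments.
Unset Strict Implicit.
Unset Printing Implicit Defensive.

Import Order.TTheory GRing.Theory Num.Theory.
Import numFieldNormedType.Exports.

Local Open Scope classical_set_scope.
Local Open Scope ring_scope.

(* The library norm on [R * R] is the max norm, hence the Euclidean norm [enorm]
   below. The topology (used for continuity) is that of the library. *)
Notation plane R := (R * R)%type.

Definition dot (R : realType) (u v : plane R) : R := u.1 * v.1 + u.2 * v.2.

Definition enorm (R : realType) (u : plane R) : R := Num.sqrt (dot u u).

Definition rotation (R : realType) (phi : R) (u : plane R) : plane R :=
  (cos phi * u.1 - sin phi * u.2, sin phi * u.1 + cos phi * u.2).

(* [Torus a] is the flat torus R^2 / (a Z)^2. The side is a parameter because no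
   disk of radius 1 embeds in R^2 / Z^2: fixing the radius to 1 normalizes the
   unit of length, which is then not at our disposal for the torus. *)
Inductive ambient (R : realType) : Type :=
| Plane : ambient R
| Torus : R -> ambient R.
Arguments Plane {R}.

(* The ambient surface is the quotient of the plane by its lattice of periods.
   Everything is described in the plane, by lifts: a subset of the surface is
   a lattice-periodic subset of the plane, and a path on the surface is given by
   one of its lifts. For the plane itself the lattice is trivial. *)
Definition lattice (R : realType) (X : ambient R) : set (plane R) :=
  match X with
  | Plane => [set 0]
  | Torus a => [set l | exists m n : int, l = (m%:~R * a, n%:~R * a)]
  end.

Section Billiard.
Context {R : realType} (X : ambient R) {m : nat}.
(* [c i] is (a lift of) the center of scatterer [i]. *)
Implicit Types (c : 'I_m.+1 -> plane R) (i : 'I_m.+1) (p x v n : plane R).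

Definition open_disk p : set (plane R) := [set x | enorm (x - p) < 1].
Definition closed_disk p : set (plane R) := [set x | enorm (x - p) <= 1].
Definition circle p : set (plane R) := [set x | enorm (x - p) = 1].

Definition lifted_center c i : set (plane R) :=
  [set p | exists2 l, lattice X l & p = c i + l].

Definition open_scatterer c i : set (plane R) :=
  \bigcup_(p in lifted_center c i) open_disk p.
Definition closed_scatterer c i : set (plane R) :=
  \bigcup_(p in lifted_center c i) closed_disk p.
Definition scatterer_boundary c i : set (plane R) :=
  \bigcup_(p in lifted_center c i) circle p.

Definition table c : set (plane R) := ~` \bigcup_i open_scatterer c i.

(* The case [i = j], [l != 0] says that each closed disk embeds in the torus. *)
Definition billiard_system c : Prop :=
  (if X is Torus a then 0 < a else True) /\
  forall i j l, lattice X l -> (i, l) <> (j, 0) ->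
    closed_disk (c i + l) `&` closed_disk (c j) = set0.

Definition move_scatterer c i p : 'I_m.+1 -> plane R :=
  fun j => if j == i then p else c j.

(* [q 0, q 1, ...] are successive collision points, lifted along the trajectory. *)
Implicit Types (q : nat -> plane R) (s : nat -> 'I_m.+1).

Definition segment q (k : nat) : set (plane R) :=
  [set x | exists t : R, 0 <= t <= 1 /\ x = q k + t *: (q k.+1 - q k)].

Definition open_segment q (k : nat) : set (plane R) :=
  [set x | exists t : R, 0 < t < 1 /\ x = q k + t *: (q k.+1 - q k)].

Definition velocity q (k : nat) : plane R :=
  (enorm (q k.+1 - q k))^-1 *: (q k.+1 - q k).

Definition specular n v : plane R := v - (2 * dot v n) *: n.

(* [phi] is the signed angle from the outer unit normal [n] of the scatterer to
   the reversed direction of motion [- v]. *)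
Definition incidence_angle n v (phi : R) : Prop :=
  - (pi / 2) <= phi <= pi / 2 /\ - v = rotation phi n.

(* A trajectory which is periodic on the surface: its lift is periodic up to a
   period of the lattice. A segment may be tangent to a scatterer at an interior
   point: such grazing collisions need not be listed in [q]. *)
Definition periodic_trajectory c (N : nat) s q : Prop :=
  [/\ (0 < N)%N,
      exists2 w, lattice X w & forall k, q (k + N)%N = q k + w,
      forall k, s (k + N)%N = s k &
      [/\ forall k, scatterer_boundary c (s k) (q k),
          forall k, q k <> q k.+1,
          forall k, segment q k `<=` table c &
          forall k p, lifted_center c (s k.+1) p -> circle p (q k.+1) ->
            velocity q k.+1 = specular (q k.+1 - p) (velocity q k)]].

Definition all_collisions_listed c q : Prop :=
  forall k i, open_segment q k `&` scatterer_boundary c i = set0.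

Definition collision_angle c s q (k : nat) (phi : R) : Prop :=
  exists p, [/\ lifted_center c (s k.+1) p, circle p (q k.+1) &
    incidence_angle (q k.+1 - p) (velocity q k) phi].

Definition singular c q : Prop :=
  exists k i p x, [/\ lifted_center c i p, circle p x, segment q k x &
    incidence_angle (x - p) (velocity q k) (pi / 2) \/
    incidence_angle (x - p) (velocity q k) (- (pi / 2))].

Definition set_distance (A B : set (plane R)) : R :=
  inf [set d | exists x y, [/\ A x, B y & d = enorm (x - y)]].

End Billiard.

(* [C g] and [Q g] are the position of scatterer 0 and the collision points at
   parameter [g]. All collisions are listed for [g < gmax]; at [g = gmax] a
   segment may become tangent to a further scatterer. *)
Definition singular_perturbation (R : realType) (X : ambient R) (m : nat)
    (c : 'I_m.+1 -> plane R) (N : nat) (s : nat -> 'I_m.+1)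
    (q : nat -> plane R) (eps : R) : Prop :=
  exists (gmax : R) (C : R -> plane R) (Q : R -> nat -> plane R),
  [/\ 0 < gmax,
      {within `[0, gmax], continuous C} /\
      (forall k, {within `[0, gmax], continuous (fun g => Q g k)}),
      C 0 = c ord0 /\ (forall k, Q 0 k = q k),
      forall g, 0 <= g <= gmax ->
        [/\ billiard_system X (move_scatterer c ord0 (C g)),
            enorm (C g - C 0) <= eps,
            periodic_trajectory X (move_scatterer c ord0 (C g)) N s (Q g) &
            g < gmax ->
              all_collisions_listed X (move_scatterer c ord0 (C g)) (Q g)] &
      singular X (move_scatterer c ord0 (C gmax)) (Q gmax)].

(* Main.v *)
Require Import Defs.
From mathcomp Require Import all_boot all_order all_algebra.
From mathcomp Require Import all_classical all_reals all_analysis.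
From mathcomp Require Import ring lra zify.
Import Order.TTheory GRing.Theory Num.Theory.
Import numFieldNormedType.Exports.
Set Implicit Arguments.
Unset Strict Implicit.
Unset Printing Implicit Defensive.
Local Open Scope classical_set_scope.
Local Open Scope ring_scope.

(** Among the closed paths whose k-th vertex lies in the k-th closed disk of the
    itinerary, the billiard orbit is the unique shortest one; this is a convex
    problem, so it has a minimizer [Q g] for every displacement [g] of scatterer 0,
    and [Q g] is continuous in [g] as long as its segments avoid the open disks.

    Scatterer 0 is pushed straight towards the nearby segment, along a fixed unit
    vector [e]. To first order the normal displacement of the orbit is a Jacobi field
    whose absolute value is convex along the orbit, by dispersion. Its boundary values
    at scatterer 0 are at most [1], because the components of [e] normal to the
    outgoing velocity [v_out] and to the incoming velocity [v_in], and their sum, are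
    at most [1]: the sum is bounded by [|v_out + v_in| = 2 |sin alpha|], which is
    where [pi / 6] enters. Away from scatterer 0 the field is even at most
    [1 / (1 + ell)], with [ell] a lower bound of the free paths. So scatterer 0
    approaches the segment at a speed bounded below in terms of the gaps between the
    scatterers only, and a segment must become tangent to some scatterer before
    scatterer 0 has moved too far. *)

(** * Euclidean plane *)

Section Coordinates.
Context {R : realType}.
Implicit Types (u v w : plane R) (a b t : R).

(** [delta] may not depend on the orbit, whose period is arbitrary, so no constant may involve [N]:
    the orbit as a whole is controlled only by the maximum principle for the Jacobi field, and
    rotation is estimated on three flights alone. Two of them meet scatterer 0: the condition
    [|v_out + v_in| <= 1] must persist during the motion, and the strict inequality
    [|alpha| < pi / 6] pays for their rotation. The third is the nearby segment, whose normal must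
    stay close to [e]. The field bounds give rotation at rate at most [2 / ell]; the constant
    [3 / ell] leaves a strict margin. Likewise the approach speed is at least
    [1 - eta - 1 / (1 + ell) = 2 * eta] with [eta = ell / (3 * (1 + ell))], and only [eta] is
    claimed. These margins let first-order information at one parameter pass to slightly larger
    ones, so that an induction along a real interval replaces a differential equation. The induction
    runs as long as the minimizer is a billiard orbit without grazing; the first parameter where
    this fails is the singular one, whichever scatterer is touched there. *)

Definition perp u : plane R := (- u.2, u.1).

Lemma scaleRE a b : a *: (b : R^o) = a * b.
Proof. by []. Qed.

End Coordinates.

(* The scalar action on the components of a pair lives in [R^o]; unfolding it lets
   [ring] and [nra] see products in [R]. *)
Ltac vec := rewrite /dot /perp /= ?scaleRE.
Ltac vring := vec; ring.
Ltac vecring := apply: injective_projections; vring.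

Section Euclid.
Context {R : realType}.
Implicit Types (u v w : plane R) (a b t : R).

Lemma dotC u v : dot u v = dot v u. Proof. by vring. Qed.
Lemma dotDl u v w : dot (u + v) w = dot u w + dot v w. Proof. by vring. Qed.
Lemma dotDr u v w : dot w (u + v) = dot w u + dot w v. Proof. by vring. Qed.
Lemma dotBl u v w : dot (u - v) w = dot u w - dot v w. Proof. by vring. Qed.
Lemma dotBr u v w : dot w (u - v) = dot w u - dot w v. Proof. by vring. Qed.
Lemma dotZl a u w : dot (a *: u) w = a * dot u w. Proof. by vring. Qed.
Lemma dotZr a u w : dot w (a *: u) = a * dot w u. Proof. by vring. Qed.
Lemma dotNl u w : dot (- u) w = - dot u w. Proof. by vring. Qed.
Lemma dot0l u : dot 0 u = 0. Proof. by vring. Qed.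
Lemma dot_ge0 u : 0 <= dot u u. Proof. by vec; nra. Qed.

Lemma enorm_ge0 u : 0 <= enorm u. Proof. exact: sqrtr_ge0. Qed.
Lemma enorm_sq u : enorm u ^+ 2 = dot u u.
Proof. by rewrite sqr_sqrtr // dot_ge0. Qed.

Lemma enorm_le u a : 0 <= a -> (enorm u <= a) = (dot u u <= a ^+ 2).
Proof. by move=> a0; rewrite -enorm_sq ler_pXn2r // nnegrE enorm_ge0. Qed.
Lemma enorm_ge u a : 0 <= a -> (a <= enorm u) = (a ^+ 2 <= dot u u).
Proof. by move=> a0; rewrite -enorm_sq ler_pXn2r // nnegrE enorm_ge0. Qed.
Lemma enorm_eq1 u : (enorm u = 1) <-> dot u u = 1.
Proof.
rewrite -enorm_sq; split=> [->|]; first by rewrite expr1n.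
by move=> h; have := enorm_ge0 u; move=> ?; nra.
Qed.

Lemma enorm0 : enorm (0 : plane R) = 0.
Proof. by rewrite /enorm dot0l sqrtr0. Qed.
Lemma enorm_eq0 u : enorm u = 0 -> u = 0.
Proof.
move=> u0; have := enorm_sq u; rewrite u0 => h.
by apply: injective_projections => /=; move: h; vec; nra.
Qed.
Lemma enormN u : enorm (- u) = enorm u.
Proof. by rewrite /enorm; congr Num.sqrt; vring. Qed.
Lemma enormZ a u : enorm (a *: u) = `|a| * enorm u.
Proof. by rewrite /enorm dotZl dotZr mulrA -expr2 sqrtrM ?sqr_ge0 // sqrtr_sqr. Qed.
Lemma enorm_dist u v : enorm (u - v) = enorm (v - u).
Proof. by rewrite -enormN opprB. Qed.

Lemma dot_perp_sq u v : dot u v ^+ 2 + dot (perp u) v ^+ 2 = dot u u * dot v v.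
Proof. by vring. Qed.

Lemma cauchy_schwarz u v : `|dot u v| <= enorm u * enorm v.
Proof.
rewrite -ler_sqr ?nnegrE ?mulr_ge0 ?enorm_ge0 //.
by rewrite exprMn !enorm_sq real_normK ?num_real // -dot_perp_sq lerDl sqr_ge0.
Qed.
Lemma dot_le u v : dot u v <= enorm u * enorm v.
Proof. exact: le_trans (ler_norm _) (cauchy_schwarz u v). Qed.

Lemma enormD u v : enorm (u + v) <= enorm u + enorm v.
Proof.
rewrite enorm_le ?addr_ge0 ?enorm_ge0 //.
have -> : dot (u + v) (u + v) = dot u u + 2 * dot u v + dot v v by vring.
by have := dot_le u v; rewrite -!enorm_sq; nra.
Qed.
Lemma enormB u v : enorm (u - v) <= enorm u + enorm v.
Proof. by rewrite -(enormN v); apply: enormD. Qed.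
Lemma enormB_ge u v : enorm u - enorm v <= enorm (u - v).
Proof. by rewrite lerBlDr -{1}(subrK v u); apply: enormD. Qed.
Lemma enormD_ge u v : enorm u - enorm v <= enorm (u + v).
Proof. by rewrite -{2}(opprK v) -(enormN v); apply: enormB_ge. Qed.

Lemma coord1_le u : `|u.1| <= enorm u.
Proof.
rewrite -ler_sqr ?nnegrE ?enorm_ge0 // enorm_sq real_normK ?num_real //.
by vec; nra.
Qed.
Lemma coord2_le u : `|u.2| <= enorm u.
Proof.
rewrite -ler_sqr ?nnegrE ?enorm_ge0 // enorm_sq real_normK ?num_real //.
by vec; nra.
Qed.
Lemma dot_le_enorm v u : enorm v = 1 -> dot v u <= enorm u.
Proof. by move=> v1; have := dot_le v u; rewrite v1 mul1r. Qed.

(** The right side equals [(|u + w|^2 + |u|^2) / (2 |u|)], so this is the inequality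
    [2xy <= x^2 + y^2]. The remainder is explicit and [w] may be of any size. *)
Lemma enorm_taylor u w : 0 < enorm u ->
  enorm (u + w) <= enorm u + dot u w / enorm u + dot w w / (2 * enorm u).
Proof.
move=> u0; set a := enorm u in u0 *.
have a2 : a ^+ 2 = dot u u by rewrite /a enorm_sq.
have E : a + dot u w / a + dot w w / (2 * a) =
   (dot (u + w) (u + w) + a ^+ 2) / (2 * a).
  rewrite a2 (_ : dot (u + w) (u + w) = a ^+ 2 + 2 * dot u w + dot w w); last first.
    by rewrite a2; vring.
  by rewrite -a2; field; rewrite gt_eqF.
rewrite E ler_pdivlMr ?mulr_gt0 // -enorm_sq.
by have := sqr_ge0 (enorm (u + w) - a); nra.
Qed.

Definition udir u := (enorm u)^-1 *: u.

Lemma enorm_udir u : 0 < enorm u -> enorm (udir u) = 1.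
Proof.
by move=> u0; rewrite enormZ gtr0_norm ?invr_gt0 // mulVf // gt_eqF.
Qed.
Lemma udirK u : 0 < enorm u -> enorm u *: udir u = u.
Proof. by move=> u0; rewrite scalerA mulfV ?scale1r // gt_eqF. Qed.
Lemma dot_udir u w : dot (udir u) w = dot u w / enorm u.
Proof. by rewrite dotZl mulrC. Qed.

Lemma perpD u v : perp (u + v) = perp u + perp v. Proof. by vecring. Qed.
Lemma dot_perp u v : dot (perp u) (perp v) = dot u v. Proof. by vring. Qed.
Lemma perp_dot0 u : dot (perp u) u = 0. Proof. by vring. Qed.
Lemma enorm_perp u : enorm (perp u) = enorm u.
Proof. by rewrite /enorm dot_perp. Qed.

Lemma decomp v u : enorm v = 1 ->
  u = dot v u *: v + dot (perp v) u *: perp v.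
Proof.
move=> /enorm_eq1; vec => h.
apply: injective_projections; vec.
  rewrite [LHS](_ : _ = u.1 * (v.1 * v.1 + v.2 * v.2)); last by rewrite h mulr1.
  by ring.
rewrite [LHS](_ : _ = u.2 * (v.1 * v.1 + v.2 * v.2)); last by rewrite h mulr1.
by ring.
Qed.

Lemma collinear v u : enorm v = 1 -> dot (perp v) u = 0 -> u = dot v u *: v.
Proof. by move=> v1 h; rewrite {1}(decomp u v1) h scale0r addr0. Qed.

End Euclid.

(** * Limits along ultrafilters *)

Section Limits.
Context {R : realType} (F : set_system nat) {FF : ProperFilter F}.
Implicit Types (f g : nat -> plane R) (a b : nat -> R) (l k : plane R).

Definition vcvg f l := (f n).1 @[n --> F] --> l.1 /\ (f n).2 @[n --> F] --> l.2.

Lemma vcvg_cst l : vcvg (fun=> l) l.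
Proof. by split; apply: cvg_cst. Qed.
Lemma vcvgD f g l k : vcvg f l -> vcvg g k -> vcvg (fun n => f n + g n) (l + k).
Proof. by move=> [? ?] [? ?]; split; apply: cvgD. Qed.
Lemma vcvgN f l : vcvg f l -> vcvg (fun n => - f n) (- l).
Proof. by move=> [? ?]; split; apply: cvgN. Qed.
Lemma vcvgB f g l k : vcvg f l -> vcvg g k -> vcvg (fun n => f n - g n) (l - k).
Proof. by move=> ? ?; apply: vcvgD => //; apply: vcvgN. Qed.
Lemma vcvgZ a f (x : R) l : a @ F --> x -> vcvg f l ->
  vcvg (fun n => a n *: f n) (x *: l).
Proof. by move=> ? [? ?]; split; apply: cvgM. Qed.
Lemma vcvg_perp f l : vcvg f l -> vcvg (fun n => perp (f n)) (perp l).
Proof. by move=> [? ?]; split => //=; apply: cvgN. Qed.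
Lemma cvg_dot f g l k : vcvg f l -> vcvg g k ->
  dot (f n) (g n) @[n --> F] --> dot l k.
Proof. by move=> [? ?] [? ?]; apply: cvgD; apply: cvgM. Qed.
Lemma cvg_enorm f l : vcvg f l -> enorm (f n) @[n --> F] --> enorm l.
Proof.
move=> h; apply: (@cvg_comp _ _ _ (fun n => dot (f n) (f n)) (@Num.sqrt R)).
  exact: (cvg_dot h h).
exact: sqrt_continuous.
Qed.
Lemma vcvg_udir f l : 0 < enorm l -> vcvg f l -> vcvg (fun n => udir (f n)) (udir l).
Proof.
move=> l0 h; apply: vcvgZ => //; apply: cvgV; first by rewrite gt_eqF.
exact: cvg_enorm.
Qed.
Lemma vcvg_unique f l k : vcvg f l -> vcvg f k -> l = k.
Proof.
move=> [f1 f2] [g1 g2]; apply: injective_projections.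
  exact: (cvg_unique (@Rhausdorff R) f1 g1).
exact: (cvg_unique (@Rhausdorff R) f2 g2).
Qed.

Lemma cvg_real_unique a (x y : R) : a @ F --> x -> a @ F --> y -> x = y.
Proof. by move=> ax ay; exact: (cvg_unique (@Rhausdorff R) ax ay). Qed.

Lemma cvg_sum K (a : 'I_K -> nat -> R) (x : 'I_K -> R) :
  (forall i, a i n @[n --> F] --> x i) ->
  \sum_i a i n @[n --> F] --> \sum_i x i.
Proof. by move=> h; apply: cvg_big => // -[? ?]; apply: cvgD; [exact: cvg_fst|exact: cvg_snd]. Qed.

Lemma lim_le a b (x y : R) : a @ F --> x -> b @ F --> y ->
  F [set n | a n <= b n] -> x <= y.
Proof. by move=> ax byy h; apply: (ler_cvg_to ax byy). Qed.

Lemma cvg_lt a (x y : R) : a @ F --> x -> x < y -> F [set n | a n < y].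
Proof. by move=> ax xy; exact: (@cvgr_lt R _ _ _ a x ax y xy). Qed.
Lemma cvg_gt a (x y : R) : a @ F --> x -> y < x -> F [set n | y < a n].
Proof. by move=> ax xy; exact: (@cvgr_gt R _ _ _ a x ax y xy). Qed.

End Limits.

(* Bounded sequences converge along [U]: this replaces extractions of subsequences. *)
Section Ultra.
Context {R : realType} (U : set_system nat) {UU : UltraFilter U}.
Context (Uoo : \oo `<=` U).

Lemma ultraC (A : set nat) : ~ U A -> U (~` A).
Proof. by move=> nA; case: (in_ultra_setVsetC A UU). Qed.

Lemma ultraI (A B : set nat) : U A -> U B -> U (A `&` B).
Proof. by move=> UA UB; apply: filterI. Qed.

Lemma ultra_inh (A : set nat) : U A -> exists n, A n.
Proof. exact: filter_ex. Qed.

Lemma ultra_fin (T : finType) (f : nat -> T) : exists c, U [set n | f n = c].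
Proof.
apply: contrapT => /forallNP h.
have : U [set n | forall c, f n <> c].
  by apply: filter_forall => c; exact: (ultraC (h c)).
by move=> /ultra_inh[n] /(_ (f n)) /(_ erefl).
Qed.

(** The limit is the supremum of the thresholds [t] with [t <= a n] for [U]-almost all [n]. For a
    larger threshold the opposite inequality holds [U]-almost everywhere, because an ultrafilter
    decides every set. *)
Lemma ulim_bounded (a : nat -> R) (B : R) : U [set n | `|a n| <= B] ->
  exists x : R, a @ U --> x.
Proof.
move=> aB; pose S := [set t | U [set n | t <= a n]].
have S0 : S (- B).
  by apply: filterS aB => n /=; rewrite ler_norml => /andP[].
have SB t : S t -> t <= B.
  move=> St; have [n [/= tn]] := ultra_inh (ultraI St aB).
  by rewrite ler_norml => /andP[_]; exact: le_trans.
have hS : has_sup S by split; [exists (- B)|exists B => t /SB].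
exists (sup S); apply/cvgrPdist_lt => e e0.
have [t St te] := sup_adherent e0 hS.
have : U [set n | ~ (sup S + e <= a n)].
  apply: ultraC => h; have := ub_le_sup hS.2 h.
  by rewrite gerDl leNgt e0.
apply: filterS2 St => n /= tn /negP; rewrite -ltNge => h.
by rewrite ltr_distl; apply/andP; split; lra.
Qed.

Lemma vulim_bounded (f : nat -> plane R) (B : R) : U [set n | enorm (f n) <= B] ->
  exists l, vcvg U f l.
Proof.
move=> fB.
have [x hx] : exists x : R, (f n).1 @[n --> U] --> x.
  by apply: (ulim_bounded (B := B)); apply: filterS fB => n; exact: le_trans (coord1_le _).
have [y hy] : exists x : R, (f n).2 @[n --> U] --> x.
  by apply: (ulim_bounded (B := B)); apply: filterS fB => n; exact: le_trans (coord2_le _).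
by exists (x, y).
Qed.

Lemma ulim_eventually (a : nat -> R) (x : R) : a @ \oo --> x -> a @ U --> x.
Proof. by move=> h A /h /Uoo. Qed.

End Ultra.

Lemma free_ultrafilter : exists U : set_system nat, UltraFilter U /\ \oo `<=` U.
Proof. exact: ultraFilterLemma. Qed.

Arguments ultraI {U} UU {A B} _ _.
Arguments ultra_inh {U} UU {A} _.
Arguments ultraC {U} UU {A} _.
Arguments ultra_fin {U} UU {T} f.

(** * Shortest closed paths through disks *)

Section Reflection.
Context {R : realType}.
Implicit Types (a b x P z G : plane R).

Lemma disk_convex P x z t : 0 <= t <= 1 -> enorm (x - P) <= 1 -> enorm (z - P) <= 1 ->
  enorm (x + t *: (z - x) - P) <= 1.
Proof.
move=> /andP[t0 t1] xP zP.
have -> : x + t *: (z - x) - P = (1 - t) *: (x - P) + t *: (z - P) by vecring.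
apply: (le_trans (enormD _ _)); rewrite !enormZ !ger0_norm ?subr_ge0 //.
by have := enorm_ge0 (x - P); have := enorm_ge0 (z - P); nra.
Qed.

Lemma le0_of_small (g C : R) : (forall t, 0 < t <= 1 -> g <= t * C) -> g <= 0.
Proof.
move=> h; rewrite leNgt; apply/negP => g0.
have C0 : g <= C by have := h 1; rewrite ltr01 lexx mul1r; apply.
have := h (g / (2 * C)); rewrite divr_gt0 ?mulr_gt0 //=; last by lra.
rewrite ler_pdivrMr ?mulr_gt0 //; last by lra.
have -> : g / (2 * C) * C = g / 2 by field; rewrite gt_eqF //; lra.
by move=> /(_ ltac:(lra)); lra.
Qed.

(** [- G] is the gradient of the length at [x], so [dot G (z - x) <= 0] for all [z] in the disk.
    Hence [x] maximizes the linear form [dot G] on the disk, which puts [x - P] in the direction of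
    [G]. *)
Lemma optimal_reflection a b x P :
  0 < enorm (x - a) -> 0 < enorm (b - x) -> enorm (x - P) <= 1 ->
  (forall z, enorm (z - P) <= 1 ->
     enorm (x - a) + enorm (b - x) <= enorm (z - a) + enorm (b - z)) ->
  let G := udir (b - x) - udir (x - a) in
  G = enorm G *: (x - P) /\ (G = 0 \/ enorm (x - P) = 1).
Proof.
move=> xa bx xP xmin G.
have VI z : enorm (z - P) <= 1 -> dot G (z - x) <= 0.
  move=> zP; set u := z - x.
  pose C := dot u u / (2 * enorm (x - a)) + dot u u / (2 * enorm (b - x)).
  apply: (@le0_of_small _ C) => t /andP[t0 t1].
  have := xmin (x + t *: u); rewrite disk_convex ?t1 ?(ltW t0) // => /(_ isT).
  have E1 : x + t *: u - a = (x - a) + t *: u by vecring.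
  have E2 : b - (x + t *: u) = (b - x) + (- t) *: u by vecring.
  have := enorm_taylor (t *: u) xa; have := enorm_taylor ((- t) *: u) bx.
  rewrite E1 E2 !dotZl !dotZr => h1 h2 h3.
  have : t * dot G u <= t * (t * C).
    have -> : dot G u = dot (b - x) u / enorm (b - x) - dot (x - a) u / enorm (x - a).
      by rewrite -!dot_udir -dotBl.
    rewrite /C; move: h1 h2 h3.
    have -> : - t * (- t * dot u u) / (2 * enorm (b - x)) =
      t * (t * (dot u u / (2 * enorm (b - x)))) by ring.
    have -> : t * (t * dot u u) / (2 * enorm (x - a)) =
      t * (t * (dot u u / (2 * enorm (x - a)))) by ring.
    have -> : - t * dot (b - x) u / enorm (b - x) =
      - (t * (dot (b - x) u / enorm (b - x))) by ring.
    have -> : t * dot (x - a) u / enorm (x - a) =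
      t * (dot (x - a) u / enorm (x - a)) by ring.
    lra.
  by rewrite ler_pM2l.
have [G0|Gn0] := eqVneq (enorm G) 0.
  by have G00 := enorm_eq0 G0; rewrite G0 scale0r; split => //; left.
have Gpos : 0 < enorm G by rewrite lt_neqAle eq_sym Gn0 enorm_ge0.
(* The test point is where [dot G] is largest on the disk. It yields [|G| <= dot G (x - P) <= |G|],
   the equality case of the Cauchy-Schwarz inequality. *)
have := VI (P + udir G); rewrite [P + _ - P]addrAC subrr add0r enorm_udir // lexx => /(_ isT).
have -> : dot G (P + udir G - x) = dot G (udir G) - dot G (x - P) by vring.
rewrite (dotC G (udir G)) dot_udir -enorm_sq expr2 mulfK // => h.
have := dot_le G (x - P) => h2.
have u1 : enorm (x - P) = 1.
  apply/eqP; rewrite eq_le xP /= -(ler_pM2l Gpos) mulr1; lra.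
split; last by right.
apply/eqP; rewrite -subr_eq0; apply/eqP; apply: enorm_eq0; apply/eqP.
rewrite eq_le enorm_ge0 andbT enorm_le // expr0n /=.
have -> : dot (G - enorm G *: (x - P)) (G - enorm G *: (x - P)) =
   dot G G - 2 * enorm G * dot G (x - P) + enorm G ^+ 2 * dot (x - P) (x - P) by vring.
by rewrite -!enorm_sq u1; nra.
Qed.

(** Strict convexity of the unit disk in quantitative form: its points lie below the tangent line at
    [x] by a quadratic amount. *)
Lemma on_circle_dot (x y P : plane R) : enorm (x - P) = 1 -> enorm (y - P) <= 1 ->
  dot (x - P) (y - x) <= - (dot (y - x) (y - x) / 2).
Proof.
move=> /enorm_eq1 h; rewrite enorm_le // expr1n.
have -> : dot (y - P) (y - P) =
  dot (x - P) (x - P) + 2 * dot (x - P) (y - x) + dot (y - x) (y - x) by vring.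
by rewrite h; lra.
Qed.

End Reflection.

Section ConvexProblem.
Context {R : realType} (N : nat) (w : plane R).
Implicit Types (x y P : nat -> plane R) (ell : R).

Definition periodic_lift x := forall k, x (k + N)%N = x k + w.

Definition spaced ell P := forall k, 2 + ell <= enorm (P k.+1 - P k).

Definition feasible P x := periodic_lift x /\ forall k, enorm (x k - P k) <= 1.

Definition step x k := x k.+1 - x k.

Definition len x : R := \sum_(k < N) enorm (step x k).

Definition minimizer P x := feasible P x /\ forall y, feasible P y -> len x <= len y.

Lemma velocityE x k : velocity x k = udir (step x k). Proof. by []. Qed.

Lemma step_per x k : periodic_lift x -> step x (k + N) = step x k.
Proof. by move=> xp; rewrite /step -addSn !xp; vecring. Qed.
Lemma velocity_per x k : periodic_lift x -> velocity x (k + N) = velocity x k.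
Proof. by move=> xp; rewrite !velocityE step_per. Qed.

Lemma feasible_step ell P x k : spaced ell P -> feasible P x -> ell <= enorm (step x k).
Proof.
move=> Ps [_ xP].
have -> : step x k = (P k.+1 - P k) - ((P k.+1 - x k.+1) - (P k - x k)) by rewrite /step; vecring.
have := enormB_ge (P k.+1 - P k) ((P k.+1 - x k.+1) - (P k - x k)).
have := enormB (P k.+1 - x k.+1) (P k - x k).
have := xP k; have := xP k.+1; have := Ps k.
rewrite (enorm_dist (x k) (P k)) (enorm_dist (x k.+1) (P k.+1)); lra.
Qed.

Lemma len_ge0 x : 0 <= len x.
Proof. by apply: sumr_ge0 => k _; apply: enorm_ge0. Qed.

Lemma sum_shift (f : nat -> R) : (forall k, f (k + N)%N = f k) ->
  \sum_(k < N) f k.+1 = \sum_(k < N) f k.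
Proof.
move=> fp; case: N fp => [|M] fp; first by rewrite !big_ord0.
rewrite big_ord_recr big_ord_recl /= addrC; congr (_ + _).
by rewrite -(fp 0%N).
Qed.

(* The reflection law makes [x] critical, and the strict convexity of the disks adds
   the terms in [lam k], which give uniqueness. *)
Lemma len_ge P x y (lam : nat -> R) ell : 0 < ell -> spaced ell P ->
  feasible P x -> feasible P y ->
  (forall k, velocity x k.+1 - velocity x k = lam k *: (x k.+1 - P k.+1)) ->
  (forall k, 0 <= lam k) -> (forall k, enorm (x k - P k) = 1) ->
  len x + \sum_(k < N) ((enorm (step y k) - dot (velocity x k) (step y k)) +
      lam k * (dot (y k.+1 - x k.+1) (y k.+1 - x k.+1) / 2)) <= len y.
Proof.
move=> ell0 Ps fx fy refl lam0 xc.
pose f k := dot (velocity x k) (y k - x k).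
have fp k : f (k + N)%N = f k.
  rewrite /f velocity_per ?fx.1 ?fy.1; last exact: fx.1.
  by congr dot; vecring.
rewrite -big_split /=.
(* The inequality holds flight by flight up to the difference [f k - f k.+1], and these differences
   cancel over a period. *)
suff T k : enorm (step x k) + ((enorm (step y k) - dot (velocity x k) (step y k)) +
      lam k * (dot (y k.+1 - x k.+1) (y k.+1 - x k.+1) / 2)) <=
      enorm (step y k) + (f k - f k.+1).
  apply: le_trans (ler_sum _ (fun (k : 'I_N) _ => T k)) _.
  by rewrite big_split /= sumrB sum_shift // subrr addr0.
have sx : dot (velocity x k) (step x k) = enorm (step x k).
  rewrite velocityE dot_udir -enorm_sq expr2 mulfK // gt_eqF //.
  exact: lt_le_trans (feasible_step k Ps fx).
have sy : step y k = step x k + (y k.+1 - x k.+1) - (y k - x k) by rewrite /step; vecring.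
have nD := on_circle_dot (xc k.+1) (fy.2 k.+1).
have -> : f k.+1 = dot (velocity x k) (y k.+1 - x k.+1) +
   lam k * dot (x k.+1 - P k.+1) (y k.+1 - x k.+1).
  by rewrite -dotZl -refl /f; vring.
have -> : dot (velocity x k) (step y k) = enorm (step x k) +
    dot (velocity x k) (y k.+1 - x k.+1) - dot (velocity x k) (y k - x k).
  by rewrite sy dotBr dotDr sx.
by have := ler_wpM2l (lam0 k) nD; rewrite /f; lra.
Qed.

Lemma periodic_eq (f : nat -> plane R) (k0 : nat) : (0 < N)%N ->
  (forall k, f (k + N)%N = f k) -> (forall k, (k0 <= k)%N -> f k = 0) ->
  forall k, f k = 0.
Proof.
move=> N0 fp h k.
have E j : f (k + j * N)%N = f k.
  elim: j => [|j IH]; first by rewrite mul0n addn0.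
  by rewrite mulSn addnCA addnC fp.
rewrite -(E k0); apply: h; apply: leq_trans (leq_addl _ _).
by rewrite leq_pmulr.
Qed.

(** The closed form of [strictly_outside]: grazing at a listed collision is allowed, so that the
    condition survives limits. *)
Definition weakly_outside P x := forall k,
  [/\ enorm (x k - P k) = 1, 0 <= dot (step x k) (x k - P k) &
      dot (step x k) (x k.+1 - P k.+1) <= 0].

(** Equal lengths make every extra term of [len_ge] vanish. A term with [lam k > 0] forces [y] and
    [x] to agree at [k.+1], which happens at [k0]. From there agreement propagates, since each step
    of [y] is parallel to the step of [x]. *)
Lemma minimizer_unique P x y (lam : nat -> R) ell k0 : (0 < N)%N -> 0 < ell ->
  spaced ell P -> periodic_lift P ->
  feasible P x -> minimizer P y ->
  (forall k, velocity x k.+1 - velocity x k = lam k *: (x k.+1 - P k.+1)) ->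
  (forall k, 0 <= lam k) -> 0 < lam k0 -> weakly_outside P x ->
  forall k, y k = x k.
Proof.
move=> N0 ell0 Ps Pp fx [fy ymin] refl lam0 lamk0 wo.
have xc k : enorm (x k - P k) = 1 by case: (wo k).
have spos k : 0 < enorm (step x k) := lt_le_trans ell0 (feasible_step k Ps fx).
pose D k : plane R := y k - x k.
have Dp k : D (k + N)%N = D k by rewrite /D fx.1 fy.1; vecring.
pose T1 k := enorm (step y k) - dot (velocity x k) (step y k).
pose T2 k := lam k * (dot (D k.+1) (D k.+1) / 2).
have T1ge k : 0 <= T1 k.
  by rewrite subr_ge0 velocityE; apply: dot_le_enorm; apply: enorm_udir.
have T2ge k : 0 <= T2 k.
  by rewrite mulr_ge0 // divr_ge0 // dot_ge0.
have lamp k : lam (k + N)%N = lam k.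
  have E j : lam j = dot (velocity x j.+1 - velocity x j) (x j.+1 - P j.+1).
    by rewrite refl dotZl -enorm_sq xc expr1n mulr1.
  rewrite !E -addSn !velocity_per ?fx.1 ?Pp; try exact: fx.1.
  by congr dot; vecring.
have T0 k : T1 k + T2 k = 0.
  have Tp j : T1 (j + N)%N + T2 (j + N)%N = T1 j + T2 j.
    rewrite /T1 /T2 lamp -addSn Dp !step_per ?velocity_per //; [exact: fx.1|exact: fy.1].
  have Tm j : T1 j + T2 j = T1 (j %% N)%N + T2 (j %% N)%N.
    rewrite {1 2}(divn_eq j N) addnC; elim: (j %/ N)%N => [|i IH].
      by rewrite mul0n addn0.
    by rewrite mulSn addnCA addnC Tp.
  have S0 : \sum_(k < N) (T1 k + T2 k) <= 0.
    have := len_ge ell0 Ps fx fy refl lam0 xc; have := ymin x fx; rewrite -/T1 -/T2.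
    by rewrite /T1 /T2 /D; lra.
  have S00 : \sum_(k < N) (T1 k + T2 k) = 0.
    by apply/eqP; rewrite eq_le S0 sumr_ge0 // => i _; rewrite addr_ge0.
  have Tge (i : 'I_N) : true -> 0 <= T1 i + T2 i by rewrite addr_ge0.
  by rewrite Tm (psumr_eq0P Tge S00 (i := Ordinal (ltn_pmod k N0))).
have T10 k : T1 k = 0 by have := T0 k; have := T1ge k; have := T2ge k; lra.
have T20 k : T2 k = 0 by have := T0 k; have := T1ge k; have := T2ge k; lra.
have Dlam k : 0 < lam k -> D k.+1 = 0.
  move=> lk; apply: enorm_eq0; apply/eqP.
  have := T20 k; rewrite /T2 -enorm_sq => /eqP.
  by rewrite !mulf_eq0 (gt_eqF lk) /= orbb invr_eq0 pnatr_eq0 orbF.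
have Dprop k : D k = 0 -> D k.+1 = 0.
  move=> Dk; have [lk|lk|lk0] := ltgtP 0 (lam k); first exact: Dlam.
    by have := lam0 k; rewrite leNgt lk.
  have v1 : enorm (velocity x k) = 1 by rewrite velocityE enorm_udir.
  have Dv : D k.+1 = dot (velocity x k) (D k.+1) *: velocity x k.
    apply: collinear => //.
    have : dot (perp (velocity x k)) (step y k) = 0.
      have := dot_perp_sq (velocity x k) (step y k).
      rewrite -enorm_sq v1 expr1n mul1r -enorm_sq.
      have -> : dot (velocity x k) (step y k) = enorm (step y k).
        by have := T10 k; rewrite /T1; lra.
      by move=> h; apply/eqP; rewrite -sqrf_eq0; apply/eqP; lra.
    have -> : step y k = step x k + D k.+1.
      move: Dk; rewrite /step /D => h; rewrite (_ : y k = x k); first by vecring.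
      by apply/eqP; rewrite -subr_eq0 h.
    rewrite dotDr; have -> : step x k = enorm (step x k) *: velocity x k by rewrite velocityE udirK.
    by rewrite dotZr perp_dot0 mulr0 add0r.
  (* With [lam k = 0] the collision is grazing. The difference [D k.+1] then points along a tangent
     of the disk, and a tangent meets the disk only at the point of contact. *)
  have [xc1 _ d2] := wo k; have [c2 d1 _] := wo k.+1.
  have vv : velocity x k.+1 = velocity x k.
    by apply/eqP; rewrite -subr_eq0 refl -lk0 scale0r.
  have vn : dot (velocity x k) (x k.+1 - P k.+1) = 0.
    apply/eqP; rewrite eq_le; apply/andP; split.
      by rewrite velocityE dot_udir pmulr_lle0 // invr_gt0.
    by rewrite -vv velocityE dot_udir divr_ge0 // enorm_ge0.
  have := on_circle_dot c2 (fy.2 k.+1).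
  have nD : dot (x k.+1 - P k.+1) (D k.+1) = 0.
    by rewrite Dv dotZr [dot (x _ - _) _]dotC vn mulr0.
  rewrite -/(D k.+1) nD -enorm_sq => h.
  apply: enorm_eq0; apply/eqP; rewrite -sqrf_eq0 eq_le sqr_ge0 andbT; lra.
have := @periodic_eq D k0.+1 N0 Dp => h k.
apply/eqP; rewrite -subr_eq0; apply/eqP; apply: h => j kj.
rewrite -(subnK kj) addnC; elim: (j - k0.+1)%N => [|i IH].
  by rewrite addn0; apply: Dlam.
by rewrite addnS; apply: Dprop.
Qed.

Lemma len_window x k : periodic_lift x ->
  len x = \sum_(i < N) enorm (step x (k + i)).
Proof.
move=> xp; elim: k => [|k ->]; first by [].
transitivity (\sum_(i < N) enorm (step x (k + i.+1))).
  apply/esym; rewrite (sum_shift (f := fun i => enorm (step x (k + i)))) // => i.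
  by rewrite addnA step_per.
by apply: eq_bigr => i _; rewrite addnS addSn.
Qed.

Lemma periodic_const_diff (x P : nat -> plane R) i j : (0 < N)%N ->
  periodic_lift x -> periodic_lift P -> i = j %[mod N] -> x i - P i = x j - P j.
Proof.
move=> N0 xp Pp.
suff E k : x k - P k = x (k %% N)%N - P (k %% N)%N by move=> ij; rewrite E ij -E.
rewrite {1 2}(divn_eq k N) addnC; elim: (k %/ N)%N => [|l IH].
  by rewrite mul0n addn0.
by rewrite mulSn addnCA addnC xp Pp -IH; vecring.
Qed.

(** The vertex [k.+1] and its translates by whole periods are moved together. As [1 < N], the
    neighbouring vertices stay, so [optimal_reflection] applies to the two steps that change. *)
Lemma minimizer_reflect P x ell k : (1 < N)%N -> 0 < ell -> spaced ell P ->
  periodic_lift P -> minimizer P x ->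
  let G := velocity x k.+1 - velocity x k in
  G = enorm G *: (x k.+1 - P k.+1) /\ (G = 0 \/ enorm (x k.+1 - P k.+1) = 1).
Proof.
move=> N1 ell0 Ps Pp [fx xmin]; have N0 := ltnW N1.
have spos j : 0 < enorm (step x j) := lt_le_trans ell0 (feasible_step j Ps fx).
rewrite /= !velocityE; apply: optimal_reflection; [exact: spos|exact: spos|exact: fx.2|].
move=> z zP.
pose y j := if j == k.+1 %[mod N] then z + (x j - x k.+1) else x j.
have yp : periodic_lift y.
  move=> j; rewrite /y modnDr; case: ifP => _; rewrite fx.1 //.
  by vecring.
have fy : feasible P y.
  split=> // j; rewrite /y; case: ifPn => [/eqP jk|_]; last exact: fx.2.
  have -> : z + (x j - x k.+1) - P j = z - P k.+1.
    have := periodic_const_diff N0 fx.1 Pp jk => h.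
    by rewrite -[RHS](subrK (x j - P j)) {1}h; vecring.
  exact: zP.
have mod_ne i a : (i < N)%N -> (0 < i)%N -> (a + i == a %[mod N]) = false.
  by move=> iN i0; rewrite -{2}[a]addn0 eqn_modDl !modn_small // gtn_eqF.
have y1 : y k.+1 = z by rewrite /y eqxx; vecring.
have yo i : (i < N)%N -> (0 < i)%N -> y (k.+1 + i)%N = x (k.+1 + i)%N.
  by move=> iN i0; rewrite /y mod_ne.
have y0 : y k = x k.
  by rewrite /y eq_sym -addn1 mod_ne.
(* The period is counted from [k], which makes the two steps that change the first two summands. *)
have := xmin y fy; rewrite (len_window k yp) (len_window k fx.1).
have [M NM] : exists M, N = M.+2 by exists N.-2; lia.
rewrite NM !big_ord_recl /= !addn0 /bump /= !addn1.
have -> : \sum_(i < M) enorm (step y (k + (1 + (1 + i)))) =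
          \sum_(i < M) enorm (step x (k + (1 + (1 + i)))).
  apply: eq_bigr => i _; rewrite /step.
  have -> : (k + (1 + (1 + i))).+1%N = (k.+1 + i.+2)%N by lia.
  have -> : (k + (1 + (1 + i)))%N = (k.+1 + i.+1)%N by lia.
  by rewrite !yo //; have := ltn_ord i; lia.
rewrite /step y1 y0 -[k.+2]addn1 yo ?addn1 //; lra.
Qed.

Lemma len_lim (F : set_system nat) {FF : ProperFilter F} (f : nat -> nat -> plane R) x :
  (forall k, vcvg F (fun n => f n k) (x k)) -> len (f n) @[n --> F] --> len x.
Proof.
by move=> h; apply: cvg_sum => i; apply: cvg_enorm; apply: vcvgB.
Qed.

Lemma feasible_lim (F : set_system nat) {FF : ProperFilter F} (f Pn : nat -> nat -> plane R) P x :
  (forall k, vcvg F (fun n => f n k) (x k)) -> (forall k, vcvg F (fun n => Pn n k) (P k)) ->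
  (forall n, feasible (Pn n) (f n)) -> feasible P x.
Proof.
move=> fx PnP ff; split=> k.
  apply: vcvg_unique (fx (k + N)%N) _.
  have -> : (fun n => f n (k + N)%N) = (fun n => f n k + w).
    by apply/funext => n; rewrite (ff n).1.
  by apply: vcvgD => //; apply: vcvg_cst.
apply: (@lim_le _ F _ (fun n => enorm (f n k - Pn n k)) (fun=> 1)).
- by apply: cvg_enorm; apply: vcvgB.
- exact: cvg_cst.
- by apply: filterE => n; apply: (ff n).2.
Qed.

(** The direct method: each vertex of a minimizing sequence stays in a fixed disk, hence converges
    along an ultrafilter. *)
Lemma minimizer_exists P : periodic_lift P -> exists x, minimizer P x.
Proof.
move=> Pp; have [U [UU Uoo]] := free_ultrafilter.
pose S := [set l | exists2 x, feasible P x & l = len x].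
have S0 : S !=set0.
  by exists (len P); exists P => //; split=> // k; rewrite subrr enorm0.
have Slb : lbound S 0 by move=> _ [x _ ->]; apply: len_ge0.
have hS : has_inf S by split=> //; exists 0.
have yex n : exists x, feasible P x /\ len x < inf S + n.+1%:R^-1.
  have [_ [x fx ->] xl] := @inf_adherent _ S n.+1%:R^-1 ltac:(by rewrite invr_gt0) hS.
  by exists x.
have [y yP] := choice yex.
have lex k : exists l, vcvg U (fun n => y n k) l.
  apply: (vulim_bounded (B := enorm (P k) + 1)); apply: filterE; move=> n /=.
  rewrite -[y n k](subrK (P k)) addrC; apply: (le_trans (enormD _ _)).
  by rewrite lerD2l; apply: (yP n).1.2.
have [x xy] := choice lex; exists x.
have fx : feasible P x.
  apply: (@feasible_lim U _ y (fun=> P)) => // [k|n]; first exact: vcvg_cst.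
  exact: (yP n).1.
split=> // z fz; apply: (@le_trans _ _ (inf S)); last first.
  by apply: ge_inf; [exists 0|exists z].
apply: (@lim_le _ U _ (fun n => len (y n)) (fun n => inf S + n.+1%:R^-1)).
- exact: len_lim.
- rewrite -[X in _ --> X]addr0; apply: cvgD; first exact: cvg_cst.
  by apply: (@ulim_eventually _ U) => //; apply: cvg_harmonic.
- by apply: filterE => n; apply: ltW; apply: (yP n).2.
Qed.

(** A competitor [z] for the limit centers becomes feasible for [Pn n] once each vertex is carried
    along with its center. The inequality of lengths then passes to the limit. *)
Lemma minimizer_lim (F : set_system nat) {FF : ProperFilter F} (f Pn : nat -> nat -> plane R) P x :
  (forall k, vcvg F (fun n => f n k) (x k)) -> (forall k, vcvg F (fun n => Pn n k) (P k)) ->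
  periodic_lift P -> (forall n, periodic_lift (Pn n)) ->
  (forall n, minimizer (Pn n) (f n)) -> minimizer P x.
Proof.
move=> fx PnP Pp Pnp fmin.
have fea : feasible P x by apply: (feasible_lim fx PnP) => n; case: (fmin n).
split=> // z fz.
pose g n k := z k + (Pn n k - P k).
have gz k : vcvg F (fun n => g n k) (z k).
  rewrite -[X in vcvg _ _ X]addr0 -(subrr (P k)).
  by apply: vcvgD; [exact: vcvg_cst|apply: vcvgB => //; exact: vcvg_cst].
apply: (lim_le (len_lim fx) (len_lim gz)).
apply: filterE => n; apply: (fmin n).2; split=> k.
  by rewrite /g fz.1 Pp Pnp; vecring.
by rewrite /g (_ : _ - _ = z k - P k); [exact: fz.2|vecring].
Qed.

End ConvexProblem.

(** * Jacobi fields *)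

(* A Jacobi field along one period, from the collision with scatterer 0 (index 0) to
   the next one (index N). [jp i] and [jm i] are the components of the displacement of
   the i-th collision point normal to the outgoing and to the incoming velocity, [a i]
   is the rotation of the normal, [c i] the cosine of the angle of incidence, [b i] the
   rotation of the velocity on the i-th flight, of length [l i]. Scatterer 0 itself
   moves by [mu * e], with normal components [mu * Ep] and [mu * Em]. *)
Section Chain.
Context {R : realType} (N : nat) (mu ell : R).
Context (jp jm a c l b : nat -> R) (Ep Em : R).
Context (N1 : (1 < N)%N) (mu0 : 0 <= mu) (ell0 : 0 < ell).
Context (l_ge : forall i, (i < N)%N -> ell <= l i)
        (b_def : forall i, (i < N)%N -> l i * b i = jm i.+1 - jp i)
        (jpE : forall i, (0 < i < N)%N -> jp i = c i * a i)
        (jmE : forall i, (0 < i < N)%N -> jm i = - (c i * a i))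
        (c_bd : forall i, (i < N)%N -> 0 <= c i <= 1)
        (b_refl : forall i, (i.+1 < N)%N -> b i.+1 + b i = 2 * a i.+1)
        (b_refl0 : b 0%N + b N.-1 = 2 * a 0%N)
        (jp0E : jp 0%N = mu * Ep + c 0%N * a 0%N)
        (jmNE : jm N = mu * Em - c 0%N * a 0%N)
        (Ep1 : `|Ep| <= 1) (Em1 : `|Em| <= 1) (Epm1 : `|Ep + Em| <= 1).

(** At interior collisions [jp i = - jm i], so the absolute value ignores the change of orientation
    under reflection. The indices 0 and [N] are the same collision, but there the motion of
    scatterer 0 makes the outgoing and incoming components differ. *)
Let y i := if i == N then `|jm N| else `|jp i|.
Let s i := (y i.+1 - y i) / l i.

Let l_gt0 i : (i < N)%N -> 0 < l i.
Proof. by move=> iN; exact: lt_le_trans ell0 (l_ge iN). Qed.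

Let y_jp i : (i < N)%N -> y i = `|jp i|.
Proof. by move=> iN; rewrite /y ltn_eqF. Qed.

Let y_jm i : (i < N)%N -> y i.+1 = `|jm i.+1|.
Proof.
move=> iN; rewrite /y; case: eqP => [->//|/eqP iN'].
have iN2 : (i.+1 < N)%N by lia.
by rewrite jpE ?jmE ?normrN.
Qed.

Let y_ge0 i : 0 <= y i.
Proof. by rewrite /y; case: ifP. Qed.

Let bE i : (i < N)%N -> b i = (jm i.+1 - jp i) / l i.
Proof. by move=> iN; rewrite -b_def // mulrAC mulfV ?mul1r // gt_eqF // l_gt0. Qed.

(* Dispersion: [y] is convex, with a jump of slope of at least [2 y] at a collision. *)
Let slope_jump i : (i.+1 < N)%N -> 2 * y i.+1 <= s i.+1 - s i.
Proof.
move=> iN; have iN' := ltnW iN.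
have [sg [sg1 sgE]] : exists sg : R, `|sg| = 1 /\ sg * a i.+1 = `|a i.+1|.
  exists (if 0 <= a i.+1 then 1 else -1); case: ifPn => [?|].
    by rewrite normr1 mul1r ger0_norm.
  by rewrite -ltNge normrN normr1 mulN1r => ?; rewrite ltr0_norm.
have sgle z : sg * z <= `|z| by rewrite (le_trans (ler_norm _)) // normrM sg1 mul1r.
have sgge z : - (sg * z) <= `|z| by have := sgle (- z); rewrite mulrN normrN.
have /andP[c0 c1] := c_bd iN.
have yE : y i.+1 = c i.+1 * `|a i.+1|.
  by rewrite y_jp // jpE // normrM ger0_norm.
have B : 2 * `|a i.+1| = sg * b i.+1 + sg * b i.
  by rewrite -sgE -mulrDr b_refl //; ring.
(* At the collision [i.+1] the sign [sg] turns the components into [y] exactly, at the far end of a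
   flight into at most [y]. So [sg * b] is bounded by the slopes of [y] on both sides. *)
have B1 : sg * b i.+1 <= s i.+1.
  rewrite bE // mulrA ler_pM2r ?invr_gt0 ?l_gt0 // mulrBr lerB //.
    by rewrite y_jm.
  by rewrite yE jpE // mulrCA sgE.
have B2 : sg * b i <= - s i.
  rewrite bE // mulrA /s -mulNr ler_pM2r ?invr_gt0 ?l_gt0 // mulrBr opprB addrC lerD //.
    by rewrite y_jp // sgge.
  by rewrite yE jmE // mulrN mulrCA sgE.
have : y i.+1 <= `|a i.+1| by rewrite yE ler_piMl.
by lra.
Qed.

Let Y := Num.max (y 0%N) (y N).

(** Maximum principle: at an interior maximum the slope before is nonnegative and the slope after
    nonpositive, so a jump of at least [2 * y] forces the maximum to be 0. *)
Let y_le i : (i <= N)%N -> y i <= Y.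
Proof.
move=> iN.
have [j [jN jmax]] : exists j, (j <= N)%N /\ forall k, (k <= N)%N -> y k <= y j.
  have [j _ jmax] := @arg_maxP _ R _ (@ord0 N) xpredT (fun i => y i) isT.
  exists j; split=> [|k kN]; first by rewrite -ltnS.
  exact: (jmax (Ordinal (kN : (k < N.+1)%N)) isT).
apply: le_trans (jmax i iN) _; rewrite /Y le_max.
have [->|j0] := eqVneq j 0%N; first by rewrite lexx.
have [->|jN'] := eqVneq j N; first by rewrite lexx orbT.
have jlt : (j < N)%N by rewrite ltn_neqAle jN'.
case: j => // k in j0 jN jN' jmax jlt *.
have := slope_jump jlt.
have s1 : s k.+1 <= 0.
  by rewrite pmulr_lle0 ?invr_gt0 ?l_gt0 // subr_le0 jmax.
have s2 : 0 <= s k.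
  by rewrite divr_ge0 ?(ltW (l_gt0 _)) ?subr_ge0 ?jmax //; lia.
by have := y_ge0 0; move=> ? ?; apply/orP; left; lra.
Qed.

(** Each slope at the collision is limited by [(Y - y i) / ell], because [y] cannot exceed [Y] one
    flight away. The jump then gives [2 * y i <= 2 * (Y - y i) / ell], whence the factor
    [1 + ell]. *)
Let y_interior i : (0 < i < N)%N -> y i * (1 + ell) <= Y.
Proof.
case: i => // i /andP[_ iN]; have iN' := ltnW iN.
have h := slope_jump iN.
have Yy := y_le iN'; have Yy2 := y_le iN; have Yy0 := y_le (ltnW iN').
have inv j : (j < N)%N -> (l j)^-1 <= ell^-1.
  by move=> jN; rewrite lef_pV2 ?posrE ?l_gt0 ?l_ge.
have s1 : s i.+1 <= (Y - y i.+1) * ell^-1.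
  apply: (@le_trans _ _ ((Y - y i.+1) / l i.+1)).
    by rewrite ler_pM2r ?invr_gt0 ?l_gt0 //; lra.
  by rewrite ler_wpM2l ?inv // subr_ge0.
have s2 : - s i <= (Y - y i.+1) * ell^-1.
  rewrite /s -mulNr; apply: (@le_trans _ _ ((Y - y i.+1) / l i)).
    by rewrite ler_pM2r ?invr_gt0 ?l_gt0 //; lra.
  by rewrite ler_wpM2l ?inv // subr_ge0.
have : y i.+1 <= (Y - y i.+1) * ell^-1 by lra.
by rewrite ler_pdivlMr //; lra.
Qed.

Let slope_mono i : (i < N)%N -> s 0%N <= s i.
Proof.
elim: i => // i IH iN; have := slope_jump iN; have := y_ge0 i.+1.
by have := IH (ltnW iN); lra.
Qed.

(* If the end values have opposite signs, convexity forces scatterer 0 to rotate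
   against them; otherwise their absolute values add up to [mu * |Ep + Em|]. *)
Let ends_le : y 0%N <= mu /\ y N <= mu.
Proof.
have N0 := ltnW N1; have Np : (N.-1 < N)%N by lia.
have NE : N.-1.+1 = N by lia.
have yN : y N = `|jm N| by rewrite /y eqxx.
rewrite yN y_jp //.
have [ss|os] := leP 0 (jp 0%N * jm N).
  have : `|jp 0%N| + `|jm N| <= mu.
    have -> : `|jp 0%N| + `|jm N| = `|jp 0%N + jm N|.
      have [p|p|p] := ltgtP 0 (jp 0%N).
      - have m0 : 0 <= jm N by rewrite -(pmulr_rge0 _ p).
        by rewrite !ger0_norm // ?addr_ge0 // ltW.
      - have m0 : jm N <= 0 by rewrite -(nmulr_rge0 _ p).
        by rewrite !ler0_norm ?opprD // ?(ltW p) //; have := ltW p; lra.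
      - by rewrite -p normr0 !add0r.
    have -> : jp 0%N + jm N = mu * (Ep + Em) by rewrite jp0E jmNE; ring.
    by rewrite normrM ger0_norm // ler_piMr.
  by have := normr_ge0 (jp 0%N); have := normr_ge0 (jm N); lra.
have [sg [sg1 sgp sgm]] : exists sg : R, [/\ `|sg| = 1, sg * jp 0%N = `|jp 0%N| &
    sg * jm N = - `|jm N|].
  have [p|p|p] := ltgtP 0 (jp 0%N).
  - exists 1; rewrite normr1 !mul1r gtr0_norm // ltr0_norm ?opprK //.
    by rewrite -(pmulr_rlt0 _ p).
  - exists (-1); rewrite normrN normr1 !mulN1r ltr0_norm // gtr0_norm //.
    by rewrite -(nmulr_rlt0 _ p).
  - by move: os; rewrite -p mul0r ltxx.
have sgle z : sg * z <= `|z| by rewrite (le_trans (ler_norm _)) // normrM sg1 mul1r.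
have sgge z : - (sg * z) <= `|z| by have := sgle (- z); rewrite mulrN normrN.
have B : sg * b 0%N <= s 0%N.
  rewrite bE // mulrA ler_pM2r ?invr_gt0 ?l_gt0 // mulrBr lerB //.
    by rewrite y_jm.
  by rewrite sgp y_jp.
have B' : sg * b N.-1 <= - s N.-1.
  rewrite bE // mulrA /s -mulNr ler_pM2r ?invr_gt0 ?l_gt0 // NE mulrBr opprB addrC lerD //.
    by rewrite y_jp // sgge.
  by rewrite yN sgm.
(* The orbit closes up: both ends belong to one collision, so [2 * sg * a 0 = sg * (b 0 + b N.-1) <=
   s 0 - s N.-1], which is nonpositive as slopes increase along the chain. *)
have A0 : sg * a 0%N <= 0.
  have := slope_mono Np.
  have : 2 * (sg * a 0%N) = sg * b 0%N + sg * b N.-1 by rewrite -mulrDr b_refl0; ring.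
  lra.
have /andP[c0 _] := c_bd N0.
have cA : c 0%N * (sg * a 0%N) <= 0 by rewrite mulr_ge0_le0.
have muE E : `|E| <= 1 -> sg * (mu * E) <= mu /\ - (sg * (mu * E)) <= mu.
  move=> E1; have : `|sg * (mu * E)| <= mu.
    by rewrite !normrM sg1 mul1r ger0_norm // ler_piMr.
  by rewrite ler_norml => /andP[]; lra.
split.
  have -> : `|jp 0%N| = sg * (mu * Ep) + c 0%N * (sg * a 0%N).
    by rewrite -sgp jp0E; ring.
  by have [+ _] := muE _ Ep1; lra.
have -> : `|jm N| = - (sg * jm N) by rewrite sgm opprK.
have -> : - (sg * jm N) = - (sg * (mu * Em)) + c 0%N * (sg * a 0%N) by rewrite jmNE; ring.
by have [_ +] := muE _ Em1; lra.
Qed.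

Lemma chain_bound :
  [/\ `|jp 0%N| <= mu, `|jm N| <= mu &
      forall i, (0 < i < N)%N -> `|c i * a i| <= mu / (1 + ell)].
Proof.
have [e0 eN] := ends_le; split.
- by rewrite -y_jp // ltnW.
- by move: eN; rewrite /y eqxx.
- move=> i iN; rewrite -jpE // -y_jp; last by case/andP: iN.
  rewrite ler_pdivlMr; last by rewrite addr_gt0.
  by apply: le_trans (y_interior iN) _; rewrite /Y ge_max e0 eN.
Qed.

End Chain.

Section Jacobi.
Context {R : realType} (N k0 : nat) (mu ell : R) (e : plane R).
Context (n v D ek : nat -> plane R) (a b c l : nat -> R).
Context (N1 : (1 < N)%N) (mu0 : 0 <= mu) (ell0 : 0 < ell).
Context (D_per : forall k, D (k + N)%N = D k) (a_per : forall k, a (k + N)%N = a k)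
        (b_per : forall k, b (k + N)%N = b k)
        (n_per : forall k, n (k + N)%N = n k) (c_per : forall k, c (k + N)%N = c k)
        (ek0 : ek k0 = e) (ek_neq0 : forall i, (0 < i < N)%N -> ek (k0 + i)%N = 0).
Context (DE : forall k, D k = mu *: ek k + a k *: perp (n k))
        (vn : forall k, dot (v k) (n k) = c k)
        (vnS : forall k, dot (v k) (n k.+1) = - c k.+1)
        (c_bd : forall k, 0 <= c k <= 1)
        (l_ge : forall k, ell <= l k)
        (lb : forall k, l k * b k = dot (perp (v k)) (D k.+1 - D k))
        (b_refl : forall k, b k.+1 + b k = 2 * a k.+1).
Let v_out := v k0.
Let v_in := v (k0 + N.-1)%N.
Context (Ep1 : `|dot (perp v_out) e| <= 1) (Em1 : `|dot (perp v_in) e| <= 1)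
        (Epm1 : `|dot (perp v_out) e + dot (perp v_in) e| <= 1).

(** [chain_bound] transferred to periodic indices. Flight [k] leaves collision [k], so the flight
    arriving at [k0 + i] is [(k0 + i).-1], and the one arriving at scatterer 0 is [k0 + N.-1], at
    the end of the period. *)
Lemma jacobi_bound :
  [/\ `|dot (perp (v k0)) (D k0)| <= mu,
      `|dot (perp v_in) (D k0)| <= mu &
      forall i, (0 < i < N)%N ->
        [/\ `|dot (perp (v (k0 + i)%N)) (D (k0 + i)%N)| <= mu / (1 + ell),
            `|dot (perp (v (k0 + i).-1)) (D (k0 + i)%N)| <= mu / (1 + ell) &
            D (k0 + i)%N = a (k0 + i)%N *: perp (n (k0 + i)%N)]].
Proof.
have NE : (k0 + N.-1).+1 = (k0 + N)%N by lia.
have dvp k : dot (perp (v k)) (perp (n k)) = c k by rewrite dot_perp.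
have dvpS k : dot (perp (v k)) (perp (n k.+1)) = - c k.+1 by rewrite dot_perp.
have jpE i : (0 < i < N)%N -> dot (perp (v (k0 + i)%N)) (D (k0 + i)%N) =
    c (k0 + i)%N * a (k0 + i)%N.
  by move=> iN; rewrite DE ek_neq0 // scaler0 add0r dotZr dvp mulrC.
have jmE i : (0 < i < N)%N -> dot (perp (v (k0 + i).-1)) (D (k0 + i)%N) =
    - (c (k0 + i)%N * a (k0 + i)%N).
  case: i => // i iN; rewrite DE ek_neq0 // scaler0 add0r dotZr addnS /= dvpS.
  by rewrite mulrN mulrC.
have NE' : (k0 + N).-1 = (k0 + N.-1)%N by lia.
have [||||||||||||h1 h2 h3] := @chain_bound R N mu ell
  (fun i => dot (perp (v (k0 + i)%N)) (D (k0 + i)%N))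
  (fun i => dot (perp (v (k0 + i).-1)) (D (k0 + i)%N))
  (fun i => a (k0 + i)%N) (fun i => c (k0 + i)%N) (fun i => l (k0 + i)%N)
  (fun i => b (k0 + i)%N) (dot (perp v_out) e) (dot (perp v_in) e) N1 mu0 ell0 => //.
- by move=> i _; rewrite addnS /= lb dotBr.
- by move=> i _; rewrite addnS b_refl.
- by rewrite addn0 -(b_per k0) -NE b_refl NE a_per.
- by rewrite addn0 {1}DE ek0 dotDr !dotZr dvp [a _ * _]mulrC.
- rewrite addn0 D_per DE ek0 NE' dotDr !dotZr -/v_in -(n_per k0) -NE dvpS NE c_per.
  by rewrite mulrN [a _ * _]mulrC.
rewrite addn0 in h1; rewrite D_per NE' in h2; split=> // i iN; split.
- by rewrite jpE // h3.
- by rewrite jmE // normrN h3.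
- by rewrite DE ek_neq0 // scaler0 add0r.
Qed.

End Jacobi.

(** * First variation of the orbit, by difference quotients along an ultrafilter *)

Section Linearize.
Context {R : realType} (F : set_system nat) {FF : ProperFilter F}.
Implicit Types (f g : nat -> plane R) (M : nat -> R) (l B : plane R).

Lemma udir_derivative f l M B : (forall n, 0 < enorm (f n)) -> 0 < enorm l ->
  vcvg F f l -> vcvg F (fun n => (M n)^-1 *: (f n - l)) B ->
  vcvg F (fun n => (M n)^-1 *: (udir (f n) - udir l))
    ((dot (perp (udir l)) B / enorm l) *: perp (udir l)).
Proof.
move=> f0 l0 fl fB; set L := enorm l in l0 *.
pose G n := (M n)^-1 *: (f n - l).
have -> : (fun n => (M n)^-1 *: (udir (f n) - udir l)) =
  (fun n => (enorm (f n))^-1 *: G n -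
     (dot (G n) (f n + l) * ((enorm (f n) + L) * enorm (f n) * L)^-1) *: l).
  apply/funext => n; set a := enorm (f n).
  have a0 : 0 < a := f0 n.
  have E : dot (f n - l) (f n + l) = (a - L) * (a + L).
    have -> : (a - L) * (a + L) = a ^+ 2 - L ^+ 2 by ring.
    by rewrite !enorm_sq; vring.
  rewrite /G dotZl E /udir -/a -/L.
  have -> : (M n)^-1 * ((a - L) * (a + L)) / ((a + L) * a * L) = (M n)^-1 * (L^-1 - a^-1).
    by rewrite -!mulrA; congr (_ * _); field; rewrite !gt_eqF ?addr_gt0.
  by vecring.
have lE : l = L *: udir l by rewrite udirK.
have dl : dot B (l + l) = 2 * L * dot (udir l) B by rewrite {1 2}lE; vring.
have -> : (dot (perp (udir l)) B / L) *: perp (udir l) =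
  L^-1 *: B - (dot B (l + l) * ((L + L) * L * L)^-1) *: l.
  have EB := decomp B (enorm_udir l0).
  have -> : L^-1 *: B = L^-1 *: (dot (udir l) B *: udir l +
      dot (perp (udir l)) B *: perp (udir l)) by rewrite -EB.
  rewrite dl [X in _ - _ *: X]lE scalerDr !scalerA.
  have -> : 2 * L * dot (udir l) B / ((L + L) * L * L) * L = L^-1 * dot (udir l) B.
    by field; rewrite !gt_eqF // ?addr_gt0.
  by rewrite [RHS]addrAC subrr add0r mulrC.
have cf := cvg_enorm fl.
apply: vcvgB.
  apply: vcvgZ; last exact: fB.
  by apply: cvgV; [rewrite gt_eqF|exact: cf].
apply: vcvgZ; last exact: vcvg_cst.
apply: cvgM.
  by apply: cvg_dot => //; apply: vcvgD => //; exact: vcvg_cst.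
apply: cvgV; first by rewrite gt_eqF // !mulr_gt0 // addr_gt0.
apply: cvgM; last exact: cvg_cst.
apply: cvgM; last exact: cf.
by apply: cvgD; [exact: cf|exact: cvg_cst].
Qed.

Lemma circle_derivative f l M B : enorm l = 1 -> F [set n | enorm (f n) = 1] ->
  vcvg F f l -> vcvg F (fun n => (M n)^-1 *: (f n - l)) B -> dot B l = 0.
Proof.
move=> l1 f1 fl fB.
have h : dot ((M n)^-1 *: (f n - l)) (f n + l) @[n --> F] --> dot B (l + l).
  by apply: cvg_dot => //; apply: vcvgD => //; exact: vcvg_cst.
have E : F [set n | dot ((M n)^-1 *: (f n - l)) (f n + l) = 0].
  apply: filterS f1 => n /= fn1.
  have -> : dot ((M n)^-1 *: (f n - l)) (f n + l) = (M n)^-1 * (dot (f n) (f n) - dot l l).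
    by vring.
  by rewrite -!enorm_sq l1 fn1 subrr mulr0.
have : dot B (l + l) = 0.
  apply/eqP; rewrite eq_le; apply/andP; split.
    by apply: (lim_le h (cvg_cst 0)); apply: filterS E => n /= ->.
  by apply: (lim_le (cvg_cst 0) h); apply: filterS E => n /= ->.
by rewrite dotDr; lra.
Qed.

End Linearize.

(** The function is quantified after [i], so that one index serves all periodic data at once,
    predicates included. The term [k0 * N] keeps the truncated subtraction in the witness exact. *)
Lemma periodic_window (N k0 k : nat) : (0 < N)%N -> exists2 i, (i < N)%N &
  forall (T : Type) (f : nat -> T), (forall j, f (j + N)%N = f j) -> f k = f (k0 + i)%N.
Proof.
move=> N0; exists ((k + k0 * N - k0) %% N)%N; first by rewrite ltn_mod.
move=> T f fp.
have fm j l : f (l + j * N)%N = f l.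
  by elim: j => [|j IH]; rewrite ?mul0n ?addn0 // mulSn addnCA addnC fp.
have kk : (k0 <= k + k0 * N)%N by apply: leq_trans (leq_addl _ _); rewrite leq_pmulr.
rewrite -(fm k0 k) -{1}(subnKC kk) {1}(divn_eq (k + k0 * N - k0) N).
by rewrite [(_ * N + _)%N]addnC addnA fm.
Qed.

Definition strictly_outside {R : realType} (P x : nat -> plane R) := forall k,
  [/\ enorm (x k - P k) = 1, 0 < dot (step x k) (x k - P k) &
      dot (step x k) (x k.+1 - P k.+1) < 0].

Section Reflect.
Context {R : realType} (N : nat) (w : plane R) (ell : R).
Context (P x : nat -> plane R).
Context (N1 : (1 < N)%N) (ell0 : 0 < ell) (Pp : periodic_lift N w P) (Ps : spaced ell P).
Context (xmin : minimizer N w P x).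

Lemma step_gt0 k : 0 < enorm (step x k).
Proof. exact: lt_le_trans ell0 (feasible_step k Ps xmin.1). Qed.

Lemma enorm_velocity k : enorm (velocity x k) = 1.
Proof. by rewrite velocityE enorm_udir // step_gt0. Qed.

Lemma velocity_step k : step x k = enorm (step x k) *: velocity x k.
Proof. by rewrite velocityE udirK // step_gt0. Qed.

Lemma velocity_refl k : velocity x k.+1 - velocity x k =
  enorm (velocity x k.+1 - velocity x k) *: (x k.+1 - P k.+1).
Proof. by have [] := minimizer_reflect k N1 ell0 Ps Pp xmin. Qed.

Lemma velocity_refl_circle k : velocity x k.+1 != velocity x k ->
  enorm (x k.+1 - P k.+1) = 1.
Proof.
have [_ [/eqP|//]] := minimizer_reflect k N1 ell0 Ps Pp xmin.
by rewrite subr_eq0 => ->.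
Qed.

Lemma dot_velocity_gt0 k u : (0 < dot (velocity x k) u) = (0 < dot (step x k) u).
Proof. by rewrite velocityE dot_udir pmulr_lgt0 // invr_gt0 step_gt0. Qed.

Lemma dot_velocity_lt0 k u : (dot (velocity x k) u < 0) = (dot (step x k) u < 0).
Proof. by rewrite velocityE dot_udir pmulr_llt0 // invr_gt0 step_gt0. Qed.

(** For unit vectors the difference of the velocities is orthogonal to their sum, and here the
    difference is a nonzero multiple of [x k.+1 - P k.+1]. *)
Lemma specular_dot k : velocity x k.+1 != velocity x k ->
  dot (velocity x k) (x k.+1 - P k.+1) = - dot (velocity x k.+1) (x k.+1 - P k.+1).
Proof.
move=> vv; set G := velocity x k.+1 - velocity x k.
have G0 : enorm G != 0.
  by apply: contra vv => /eqP/enorm_eq0/eqP; rewrite subr_eq0.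
have : dot G (velocity x k.+1 + velocity x k) = 0.
  have -> : dot G (velocity x k.+1 + velocity x k) =
    dot (velocity x k.+1) (velocity x k.+1) - dot (velocity x k) (velocity x k) by vring.
  by rewrite -!enorm_sq !enorm_velocity subrr.
rewrite /G velocity_refl dotZl => /eqP; rewrite mulf_eq0 (negbTE G0) /= => /eqP.
by rewrite dotC dotDl; lra.
Qed.

Lemma outside_velocity_neq k : strictly_outside P x -> velocity x k.+1 != velocity x k.
Proof.
move=> xo; apply/eqP => vv.
have [_ _] := xo k; have [_ + _] := xo k.+1.
by rewrite -dot_velocity_gt0 -dot_velocity_lt0 vv => p1 /(lt_trans p1); rewrite ltxx.
Qed.

Lemma minimizer_unique' y k : velocity x k.+1 != velocity x k ->
  weakly_outside P x -> minimizer N w P y -> forall j, y j = x j.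
Proof.
move=> vv xo ymin; have N0 := ltnW N1.
apply: (@minimizer_unique R N w P x y
  (fun k => enorm (velocity x k.+1 - velocity x k)) ell k) => //.
- exact: xmin.1.
- exact: velocity_refl.
- by move=> j; exact: enorm_ge0.
- rewrite lt_neqAle enorm_ge0 andbT eq_sym.
  by apply: contra vv => /eqP/enorm_eq0/eqP; rewrite subr_eq0.
Qed.

End Reflect.

Section Linearization.
Context {R : realType} (N : nat) (w e : plane R) (P0 ek : nat -> plane R) (k0 : nat) (ell g1 : R).
Context (N1 : (1 < N)%N) (ell0 : 0 < ell) (P0p : periodic_lift N w P0)
  (ekp : forall k, ek (k + N)%N = ek k) (ek0 : ek k0 = e)
  (ekn0 : forall i, (0 < i < N)%N -> ek (k0 + i)%N = 0) (e1 : enorm e = 1).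
Let P g k := P0 k + g *: ek k.
Context (Ps : forall g : R, 0 <= g <= g1 -> spaced ell (P g)).
Context (Q : R -> nat -> plane R) (Qmin : forall g, minimizer N w (P g) (Q g)).
Context (U : set_system nat) (UU : UltraFilter U).

Lemma center_per g : periodic_lift N w (P g).
Proof. by move=> k; rewrite /P P0p ekp; vecring. Qed.

(* Dividing by [M], which dominates both the displacement of scatterer 0 and that of the
   orbit, makes all quotients bounded, so that no differentiability of [Q] is needed
   beforehand; [mu = 0] is excluded because the limit field would then vanish. *)
Lemma linearization (g : R) (y : nat -> R) :
  0 <= g <= g1 -> strictly_outside (P g) (Q g) ->
  (forall n, g < y n <= g1) -> y @ U --> g ->
  (forall k, U [set n | enorm (Q (y n) k - P (y n) k) = 1]) ->
  (forall k, vcvg U (fun n => Q (y n) k) (Q g k)) ->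
  let v := velocity (Q g) in
  enorm (v k0 + v (k0 + N.-1)%N) <= 1 ->
  exists M : nat -> R, exists mu : R, exists A : nat -> plane R,
  [/\ forall n, 0 < M n,
      0 < mu /\ (y n - g) / M n @[n --> U] --> mu,
      forall k, vcvg U (fun n => (M n)^-1 *: (Q (y n) k - Q g k)) (A k),
      forall k, vcvg U (fun n => (M n)^-1 *: (velocity (Q (y n)) k - v k))
        ((dot (perp (v k)) (A k.+1 - A k) / enorm (step (Q g) k)) *: perp (v k)) &
      [/\ `|dot (perp (v k0)) (A k0)| <= mu,
      `|dot (perp (v (k0 + N.-1)%N)) (A (k0 + N)%N)| <= mu &
      forall i, (0 < i < N)%N ->
        `|dot (perp (v (k0 + i)%N)) (A (k0 + i)%N)| <= mu / (1 + ell) /\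
        `|dot (perp (v (k0 + i).-1)) (A (k0 + i)%N)| <= mu / (1 + ell)]].
Proof.
move=> g01 Qo yg yU Qc Qcv v vsum; have N0 := ltnW N1.
have /andP[g0 gg1] := g01.
have y01 n : 0 <= y n <= g1.
  by have /andP[h1 ->] := yg n; rewrite andbT ltW // (le_lt_trans g0).
have Pg := Ps g01; have Py n := Ps (y01 n).
have Pp := center_per.
pose D n k := Q (y n) k - Q g k.
have Dp n k : D n (k + N)%N = D n k by rewrite /D !(Qmin _).1.1; vecring.
pose M n := (y n - g) + \sum_(k < N) enorm (D n k).
have yg0 n : 0 < y n - g by rewrite subr_gt0; case/andP: (yg n).
have M0 n : 0 < M n.
  by apply: ltr_pwDl; [exact: yg0|apply: sumr_ge0 => k _; exact: enorm_ge0].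
have DM n k : enorm (D n k) <= M n.
  have [i iN E] := periodic_window 0 k N0.
  rewrite (E _ (D n) (Dp n)) add0n /M (bigD1 (Ordinal iN)) //= addrCA lerDl.
  by apply: addr_ge0; [exact: ltW|apply: sumr_ge0 => j _; exact: enorm_ge0].
have Aex k : exists l, vcvg U (fun n => (M n)^-1 *: D n k) l.
  apply: (vulim_bounded (B := 1)); apply: filterE; move=> n /=.
  by rewrite enormZ gtr0_norm ?invr_gt0 // mulrC ler_pdivrMr // mul1r.
have [A DA] := choice Aex.
have r0 n : 0 <= (y n - g) / M n by apply: divr_ge0; apply: ltW.
have [mu ymu] : exists mu : R, (y n - g) / M n @[n --> U] --> mu.
  apply: (ulim_bounded (B := 1)); apply: filterE; move=> n /=; rewrite ger0_norm //.
  by rewrite ler_pdivrMr // mul1r lerDl; apply: sumr_ge0 => k _; exact: enorm_ge0.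
have mu0 : 0 <= mu.
  by apply: (lim_le (cvg_cst 0) ymu); apply: filterE.
have Ap k : A (k + N)%N = A k.
  apply: vcvg_unique (DA (k + N)%N) _.
  by rewrite (_ : (fun n => _) = (fun n => (M n)^-1 *: D n k)) //; apply/funext => n; rewrite Dp.
have vp k : v (k + N)%N = v k by rewrite /v (velocity_per k (Qmin g).1.1).
pose n k := Q g k - P g k.
have n1 k : enorm (n k) = 1 by case: (Qo k).
have np k : n (k + N)%N = n k by rewrite /n (Qmin g).1.1 Pp; vecring.
pose nn i k := Q (y i) k - P (y i) k.
have dn k : vcvg U (fun i => (M i)^-1 *: (nn i k - n k)) (A k - mu *: ek k).
  have -> : (fun i => (M i)^-1 *: (nn i k - n k)) =
     (fun i => (M i)^-1 *: D i k - ((y i - g) / M i) *: ek k).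
    by apply/funext => i; rewrite /nn /n /D /P; vecring.
  by apply: vcvgB => //; apply: vcvgZ => //; exact: vcvg_cst.
pose a k := dot (perp (n k)) (A k - mu *: ek k).
have nnn k : vcvg U (fun i => nn i k) (n k).
  apply: vcvgB; first exact: Qcv.
  by apply: vcvgD; [exact: vcvg_cst|apply: vcvgZ => //; exact: vcvg_cst].
have an k : A k = mu *: ek k + a k *: perp (n k).
  have h : dot (n k) (A k - mu *: ek k) = 0.
    by rewrite dotC; apply: (circle_derivative (n1 k) (Qc k) (nnn k) (dn k)).
  by rewrite -[LHS](subrK (mu *: ek k)) {1}(decomp (A k - mu *: ek k) (n1 k)) h scale0r add0r addrC.
have sp k : 0 < enorm (step (Q g) k) := step_gt0 ell0 Pg (Qmin g) k.
pose b k := dot (perp (v k)) (A k.+1 - A k) / enorm (step (Q g) k).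
have dv k : vcvg U (fun i => (M i)^-1 *: (velocity (Q (y i)) k - v k)) (b k *: perp (v k)).
  apply: (udir_derivative _ (sp k)) => [i||]; first exact: step_gt0 ell0 (Py i) (Qmin _) k.
    by apply: vcvgB; apply: Qcv.
  rewrite (_ : (fun i => _) = (fun i => (M i)^-1 *: D i k.+1 - (M i)^-1 *: D i k)); last first.
    by apply/funext => i; rewrite /D /step; vecring.
  exact: vcvgB.
have vcv k : vcvg U (fun i => velocity (Q (y i)) k) (v k).
  by apply: vcvg_udir; [exact: sp|apply: vcvgB; apply: Qcv].
pose c k := dot (v k) (n k).
have cpos k : 0 < c k.
  by rewrite /c /v (dot_velocity_gt0 ell0 Pg (Qmin g)); case: (Qo k).
have vneq k := outside_velocity_neq ell0 Pg (Qmin g) k Qo.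
have vnS k : dot (v k) (n k.+1) = - c k.+1.
  exact: (specular_dot N1 ell0 (Pp g) Pg (Qmin g) (vneq k)).
have brefl k : b k.+1 + b k = 2 * a k.+1.
  (* [fi i] is the change of [dot (v k.+1 - v k) (perp (n k.+1))] divided by [M i], split by the
     product rule. By the reflection law this quantity is 0 at both parameters. *)
  pose fi i := dot ((M i)^-1 *: (velocity (Q (y i)) k.+1 - v k.+1) -
      (M i)^-1 *: (velocity (Q (y i)) k - v k)) (perp (nn i k.+1)) +
    dot (v k.+1 - v k) (perp ((M i)^-1 *: (nn i k.+1 - n k.+1))).
  have fi0 i : fi i = 0.
    have E1 := velocity_refl N1 ell0 (Pp (y i)) (Py i) (Qmin (y i)) k.
    have E2 := velocity_refl N1 ell0 (Pp g) Pg (Qmin g) k.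
    have -> : fi i = (M i)^-1 * (dot (velocity (Q (y i)) k.+1 - velocity (Q (y i)) k)
       (perp (nn i k.+1)) - dot (v k.+1 - v k) (perp (n k.+1))).
      by rewrite /fi; vring.
    by rewrite E1 /v E2 !dotZl -/(nn i k.+1) -/(n k.+1) ![dot _ (perp _)]dotC !perp_dot0
      !mulr0 subrr mulr0.
  have fl : fi i @[i --> U] --> dot (b k.+1 *: perp (v k.+1) - b k *: perp (v k)) (perp (n k.+1)) +
      dot (v k.+1 - v k) (perp (A k.+1 - mu *: ek k.+1)).
    apply: cvgD; apply: cvg_dot; [exact: vcvgB|exact: vcvg_perp|exact: vcvg_cst|exact: vcvg_perp].
  have f0 : fi i @[i --> U] --> (0 : R).
    by rewrite (_ : fi = fun=> 0); [exact: cvg_cst|exact/funext].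
  have := cvg_real_unique fl f0.
  have -> : A k.+1 - mu *: ek k.+1 = a k.+1 *: perp (n k.+1) by rewrite an; vecring.
  have -> : dot (b k.+1 *: perp (v k.+1) - b k *: perp (v k)) (perp (n k.+1)) =
      (b k.+1 + b k) * c k.+1.
    by rewrite dotBl !dotZl !dot_perp vnS -/(c k.+1); ring.
  have -> : dot (v k.+1 - v k) (perp (a k.+1 *: perp (n k.+1))) = - (2 * a k.+1 * c k.+1).
    have -> : perp (a k.+1 *: perp (n k.+1)) = (- a k.+1) *: n k.+1 by vecring.
    by rewrite dotZr dotBl vnS -/(c k.+1); ring.
  (* The identity comes out multiplied by the cosine [c k.+1], which is positive because nothing
     grazes at [g]. *)
  move=> h; apply: (mulIf (lt0r_neq0 (cpos k.+1))).
  exact: (subr0_eq (h _)).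
have bp k : b (k + N)%N = b k by rewrite /b -addSn !Ap vp (step_per k (Qmin g).1.1).
have ap k : a (k + N)%N = a k by rewrite /a Ap np ekp.
have cp k : c (k + N)%N = c k by rewrite /c vp np.
have v1 k : enorm (v k) = 1 := enorm_velocity ell0 Pg (Qmin g) k.
have e_le u : `|dot (perp u) e| <= enorm u.
  by apply: (le_trans (cauchy_schwarz _ _)); rewrite e1 mulr1 enorm_perp.
have [] := @jacobi_bound R N k0 mu ell e n v A ek a b c (fun k => enorm (step (Q g) k)) N1 mu0
  ell0 Ap ap bp np cp ek0 ekn0 an => //.
- by move=> k; rewrite ltW ?cpos //= /c (le_trans (dot_le _ _)) // v1 n1 mulr1.
- by move=> k; exact: feasible_step Pg (Qmin g).1.
- by move=> k; rewrite mulrC divfK // gt_eqF.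
- by rewrite -(v1 k0).
- by rewrite -(v1 (k0 + N.-1)%N).
- rewrite -dotDl -perpD; exact: le_trans (e_le _) vsum.
move=> B1 B2 B3.
have mupos : 0 < mu.
  rewrite lt_neqAle mu0 andbT; apply/eqP => mu00; move: an B1 B3; rewrite -mu00 mul0r => an B1 B3.
  have Awin i : (i < N)%N -> A (k0 + i)%N = 0.
    move=> iN.
    have h : dot (perp (v (k0 + i)%N)) (A (k0 + i)%N) = 0.
      apply/eqP; rewrite -normr_le0; case: i iN => [|i] iN; first by rewrite addn0.
      by have [] := B3 i.+1 iN.
    move: h; rewrite an scale0r add0r dotZr dot_perp -/(c _) => /eqP.
    by rewrite mulf_eq0 (gt_eqF (cpos _)) orbF => /eqP ->; rewrite scale0r.
  have A0 k : A k = 0.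
    by have [i iN E] := periodic_window k0 k N0; rewrite (E _ A Ap) Awin.
  have S1 : (y i - g) / M i + \sum_(k < N) enorm ((M i)^-1 *: D i k) @[i --> U] -->
     mu + \sum_(k < N) enorm (A k).
    apply: cvgD; first exact: ymu.
    apply: cvg_sum => k. exact: (cvg_enorm (DA k)).
  have S2 : (y i - g) / M i + \sum_(k < N) enorm ((M i)^-1 *: D i k) @[i --> U] --> (1 : R).
    rewrite (_ : (fun i => _) = fun=> 1); first exact: cvg_cst.
    apply/funext => i; rewrite (eq_bigr (fun k : 'I_N => enorm (D i k) / M i)); last first.
      by move=> k _; rewrite enormZ gtr0_norm ?invr_gt0 // mulrC.
    by rewrite -mulr_suml -mulrDl; apply: mulfV; rewrite gt_eqF ?M0.
  have h : mu + \sum_(k < N) enorm (A k) = 1 := cvg_real_unique S1 S2.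
  move: h; rewrite -mu00 big1 ?addr0 => [h|k _]; last by rewrite A0 enorm0.
  by have := @ltr01 R; rewrite -h ltxx.
exists M, mu, A; split; [exact: M0|by split|exact: DA|exact: dv|].
by split=> [||i /B3[]//]; [exact: B1|rewrite Ap].
Qed.

End Linearization.

Section Inequalities.
Context {R : realFieldType}.

Lemma norm_interpolate (p q T B : R) : 0 <= T <= 1 -> `|p| <= B -> `|q| <= B ->
  `|p + T * (q - p)| <= B.
Proof.
rewrite !ler_norml => /andP[? ?] /andP[? ?] /andP[? ?].
by apply/andP; split; nra.
Qed.

Lemma norm1_of_sqr (x : R) : x ^+ 2 = 1 -> `|x| = 1.
Proof. by move=> /eqP; rewrite sqrf_eq1 => /orP[]/eqP->; rewrite ?normrN normr1. Qed.

(** [D] is the cosine of the rotation of the normal since the start and [- J] the retreat of the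
    segment. The scatterer gains at least [(1 - eta) - (1 - 3 * eta) = 2 * eta] per unit of motion,
    against the supposed [eta]. *)
Lemma approach_rate (mu eta K D J : R) : 0 < mu -> 0 < eta -> K <= eta -> 1 - K <= D ->
  - (eta * mu) <= - mu * D - J -> - J <= mu * (1 - 3 * eta) -> False.
Proof.
move=> mu0 eta0 Keta KD h1 h2; have := mulr_gt0 mu0 eta0.
have : mu * (1 - eta) <= mu * D by rewrite ler_pM2l //; lra.
by lra.
Qed.

End Inequalities.

(** * Induction along a real interval, and continuity tested on sequences *)

Section RealInduction.
Context {R : realType}.

(** The property holds at the infimum of its failures by the closedness step, and then failures
    accumulate there from the right. The step to the right asks for a single good term of a
    sequence, which is what a limit argument along an ultrafilter delivers. *)
Lemma real_induction (Pr : R -> Prop) (T : R) : Pr 0 ->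
  (forall x : R, 0 < x <= T -> (forall y, 0 <= y < x -> Pr y) -> Pr x) ->
  (forall x : R, 0 <= x < T -> Pr x -> forall y : nat -> R, (forall n, x < y n <= T) ->
     y @ \oo --> x -> exists n, Pr (y n)) ->
  forall x : R, 0 <= x <= T -> Pr x.
Proof.
move=> P0 Pclosed Popen z z01; apply: contrapT => nPz.
pose S := [set x | 0 <= x <= T /\ ~ Pr x].
have Sz : S z by [].
have hS : has_inf S by split; [exists z|exists 0 => x [/andP[]]].
have Slb : lbound S (inf S) by move=> x Sx; apply: ge_inf => //; exact: hS.2.
have i0 : 0 <= inf S by apply: lb_le_inf => //; [exists z|move=> x [/andP[]]].
have iz : inf S <= z by exact: Slb.
have /andP[z0 zT] := z01.
have below y : 0 <= y < inf S -> Pr y.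
  move=> /andP[y0 yi]; apply: contrapT => nPy.
  have : S y by split=> //; rewrite y0 /=; lra.
  by move=> /Slb; rewrite leNgt yi.
have Pi : Pr (inf S).
  have [->//|i0'] := eqVneq (inf S) 0.
  by apply: Pclosed => //; rewrite lt_neqAle eq_sym i0' i0 (le_trans iz).
have iT : inf S < T.
  rewrite lt_neqAle (le_trans iz zT) andbT; apply/eqP => E; apply: nPz.
  by rewrite (_ : z = inf S) //; apply/eqP; rewrite eq_le iz E zT.
have ex n : exists y, S y /\ y < inf S + n.+1%:R^-1.
  by have [y Sy yl] := @inf_adherent _ S n.+1%:R^-1 ltac:(by rewrite invr_gt0) hS; exists y.
have [y yP] := choice ex.
have [n] : exists n, Pr (y n).
  apply: (Popen (inf S)) => //; first by rewrite i0.
    move=> n; have [[/andP[y0 yT] nPy] _] := yP n; rewrite yT andbT lt_neqAle.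
    by rewrite Slb ?andbT; [apply/eqP => E; apply: nPy; rewrite -E|have [] := yP n].
  apply: (@squeeze_cvgr _ _ _ _ (fun=> inf S) (fun n => inf S + n.+1%:R^-1)).
  - by apply: nearW => n; have [Sy /ltW ->] := yP n; rewrite Slb.
  - exact: cvg_cst.
  - by rewrite -[X in _ --> X]addr0; apply: cvgD; [exact: cvg_cst|exact: cvg_harmonic].
by have [[]] := yP n.
Qed.

End RealInduction.

Section WithinContinuity.
Context {R : realType}.

Lemma within_continuous_ultra (f : R -> plane R) (T : R) :
  (forall U : set_system nat, UltraFilter U -> forall (g : R) (y : nat -> R), 0 <= g <= T ->
     (forall n, 0 <= y n <= T) -> y @ U --> g -> vcvg U (fun n => f (y n)) (f g)) ->
  {within `[0, T], continuous f}.
Proof.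
move=> h; have [U [UU Uoo]] := free_ultrafilter.
apply/subspace_continuousP => g /=; rewrite in_itv /= => g01 A nA.
apply: contrapT => nB.
have ex n : exists z : R, [/\ 0 <= z <= T, `|g - z| < n.+1%:R^-1 & ~ A (f z)].
  apply: contrapT => no; apply: nB; rewrite /= /within /=.
  have n0 : 0 < n.+1%:R^-1 :> R by rewrite invr_gt0.
  apply: filterS (nbhsx_ballx g _ n0) => z gz; rewrite in_itv /= => z01.
  by apply: contrapT => nAz; apply: no; exists z.
have [y yP] := choice ex.
have yg : y @ \oo --> g.
  apply/cvgrPdist_lt => e e0.
  have /cvgrPdist_lt/(_ e e0) h0 : (fun n => n.+1%:R^-1 : R) @ \oo --> (0 : R).
    exact: cvg_harmonic.
  apply: filterS h0 => n /=; rewrite sub0r normrN gtr0_norm ?invr_gt0 // => hn.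
  by have [_ h2 _] := yP n; exact: lt_trans h2 hn.
have [l1 l2] := h U UU g y g01 (fun n => let: And3 h1 _ _ := yP n in h1) (ulim_eventually Uoo yg).
have l : (fun n => ((f (y n)).1, (f (y n)).2)) @ U --> ((f g).1, (f g).2).
  exact: (cvg_pair l1 l2).
have := l A; rewrite -surjective_pairing => /(_ nA) UA.
have [n] := ultra_inh UU UA.
have [_ _ nAf] := yP n; move=> Af; apply: nAf.
by rewrite [f (y n)]surjective_pairing.
Qed.

End WithinContinuity.

(** * Rays leaving a unit circle, and tangency *)

Section Tangency.
Context {R : realType}.
Implicit Types (n d r v : plane R) (t : R).

Lemma enorm_ray n d t : enorm n = 1 ->
  enorm (n + t *: d) ^+ 2 = 1 + t * (2 * dot d n + t * dot d d).
Proof.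
move=> /enorm_eq1 n1; rewrite enorm_sq.
have -> : dot (n + t *: d) (n + t *: d) = dot n n + t * (2 * dot d n + t * dot d d) by vring.
by rewrite n1.
Qed.

Lemma ray_outside n d t : enorm n = 1 -> 0 <= dot d n -> 0 <= t -> 1 <= enorm (n + t *: d).
Proof.
move=> n1 dn t0; rewrite -(@ler_pXn2r _ 2) ?nnegrE ?enorm_ge0 // expr1n enorm_ray //.
by rewrite lerDl mulr_ge0 // addr_ge0 ?mulr_ge0 // dot_ge0.
Qed.

Lemma ray_strictly_outside n d t : enorm n = 1 -> 0 < dot d n -> 0 < t -> 1 < enorm (n + t *: d).
Proof.
move=> n1 dn t0; rewrite -(@ltr_pXn2r _ 2) ?nnegrE ?enorm_ge0 // expr1n enorm_ray //.
by rewrite ltrDl mulr_gt0 // ltr_wpDr ?mulr_ge0 ?dot_ge0 ?mulr_gt0 // ltW.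
Qed.

Lemma outside_dot_ge0 n d : enorm n = 1 ->
  (forall t, 0 < t <= 1 -> 1 <= enorm (n + t *: d)) -> 0 <= dot d n.
Proof.
move=> n1 h; suff : - (2 * dot d n) <= 0 by lra.
apply: (@le0_of_small _ _ (dot d d)) => t t01; have /andP[t0 _] := t01.
have := h t t01; rewrite -(@ler_pXn2r _ 2) ?nnegrE ?enorm_ge0 // expr1n enorm_ray //.
by rewrite lerDl pmulr_rge0 //; lra.
Qed.

Lemma interior_touch_dot0 r d (t1 : R) : enorm r = 1 -> 0 < t1 ->
  (forall t, `|t| <= t1 -> 1 <= enorm (r + t *: d)) -> dot d r = 0.
Proof.
move=> r1 t10 h.
have h1 : 0 <= dot (t1 *: d) r.
  apply: outside_dot_ge0 => // t /andP[t0 t1']; rewrite scalerA; apply: h.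
  by rewrite normrM (gtr0_norm t0) (gtr0_norm t10) ler_piMl // ltW.
have h2 : 0 <= dot ((- t1) *: d) r.
  apply: outside_dot_ge0 => // t /andP[t0 t1']; rewrite scalerA; apply: h.
  by rewrite normrM normrN (gtr0_norm t0) (gtr0_norm t10) ler_piMl // ltW.
move: h1 h2; rewrite !dotZl pmulr_rge0 // mulNr oppr_ge0 pmulr_rle0 // => h1 h2.
by apply/eqP; rewrite eq_le h1 h2.
Qed.

Lemma tangent_incidence n v : enorm n = 1 -> enorm v = 1 -> dot v n = 0 ->
  incidence_angle n v (pi / 2) \/ incidence_angle n v (- (pi / 2)).
Proof.
move=> n1 v1 vn; have pi0 : 0 <= pi / 2 :> R by rewrite divr_ge0 // pi_ge0.
have E : v = dot (perp n) v *: perp n.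
  by rewrite {1}(decomp v n1) dotC vn scale0r add0r.
have [k1|k1] : dot (perp n) v = 1 \/ dot (perp n) v = -1.
  have : dot (perp n) v ^+ 2 = 1.
    have := dot_perp_sq n v; rewrite dotC vn expr0n add0r => ->.
    by rewrite -!enorm_sq n1 v1 !expr1n mulr1.
  by move=> /eqP; rewrite sqrf_eq1 => /orP[] /eqP; [left|right].
- right; split; first by apply/andP; split; lra.
  rewrite E k1 scale1r /rotation cosN sinN cos_pihalf sin_pihalf.
  by vecring.
- left; split; first by apply/andP; split; lra.
  rewrite E k1 /rotation cos_pihalf sin_pihalf.
  by vecring.
Qed.

End Tangency.

(** * The lattice of periods and the gap between scatterers *)

Section Lattice.
Context {R : realType} (X : ambient R).

Lemma lattice0 : lattice X 0.
Proof. by case: X => [|a] //=; exists 0, 0; rewrite !mul0r. Qed.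

Lemma latticeB u v : lattice X u -> lattice X v -> lattice X (u - v).
Proof.
case: X => [|a] /=; first by move=> -> ->; rewrite subr0.
move=> [m [n ->]] [m' [n' ->]]; exists (m - m'), (n - n').
by rewrite !intrB; apply: injective_projections => /=; ring.
Qed.

Lemma latticeN u : lattice X u -> lattice X (- u).
Proof. by move=> hu; rewrite -sub0r; apply: latticeB => //; exact: lattice0. Qed.

Lemma latticeD u v : lattice X u -> lattice X v -> lattice X (u + v).
Proof. by move=> hu hv; rewrite -[v]opprK; apply: latticeB => //; apply: latticeN. Qed.

Context (U : set_system nat) {UU : UltraFilter U}.

(** Discreteness: a bounded sequence converges along [U], and two multiples of [a] less than [a / 2]
    away from the same number coincide. *)
Lemma lattice_ultra_const (L : nat -> plane R) (B : R) :
  (if X is Torus a then 0 < a else True) ->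
  U [set n | lattice X (L n) /\ enorm (L n) <= B] ->
  exists2 l, lattice X l & U [set n | L n = l].
Proof.
case: X => [_|a a0] UL.
  by exists 0 => //; apply: filterS UL => n [].
have [l [l1 l2]] : exists l, vcvg U L l.
  by apply: (vulim_bounded (B := B)); apply: filterS UL => n [].
have a2 : 0 < a / 2 by rewrite divr_gt0.
have U1 : U [set n | `|l.1 - (L n).1| < a / 2] by move/cvgrPdist_lt : l1; exact.
have U2 : U [set n | `|l.2 - (L n).2| < a / 2] by move/cvgrPdist_lt : l2; exact.
have UA := ultraI UU UL (ultraI UU U1 U2).
have [n0 [[Ln0 _] [/= d1 d2]]] := ultra_inh UU UA.
exists (L n0) => //; apply: filterS UA => n [[[m [k Ln]] _] [/= d1' d2']].
case: Ln0 => m0 [k0 Ln0].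
have E (i j : int) (x : R) : `|x - i%:~R * a| < a / 2 -> `|x - j%:~R * a| < a / 2 -> i = j.
  move=> h1 h2.
  have h : `|(i - j)%:~R| * a < 1 * a.
    rewrite mul1r -[X in _ * X < _](gtr0_norm a0) -normrM.
    have -> : (i - j)%:~R * a = (x - j%:~R * a) - (x - i%:~R * a) by rewrite intrB; ring.
    by apply: le_lt_trans (ler_normB _ _) _; lra.
  rewrite ltr_pM2r // -intr_norm -[1]/(1%:~R) ltr_int in h.
  by lia.
move: d1 d2 d1' d2'; rewrite Ln Ln0 /= => d1 d2 d1' d2'.
by rewrite (E _ _ _ d1' d1) (E _ _ _ d2' d2).
Qed.

End Lattice.

Section Gap.
Context {R : realType} (X : ambient R) (m : nat) (c : 'I_m.+1 -> plane R).
Context (bs : billiard_system X c).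

(** Otherwise the midpoint of the two centers would lie in both closed disks. *)
Lemma centers_dist i j l : lattice X l -> (i, l) <> (j, 0) -> 2 < enorm (c i + l - c j).
Proof.
move=> hl ij; rewrite ltNge; apply/negP => h.
have := bs.2 i j l hl ij; rewrite -subset0 => /(_ (c j + 2^-1 *: (c i + l - c j))); apply.
have n2 : `|2^-1| = 2^-1 :> R by rewrite ger0_norm // invr_ge0.
split; rewrite /closed_disk /=.
  rewrite (_ : _ - _ = - (2^-1 *: (c i + l - c j))).
    by rewrite enormN enormZ n2; lra.
  by apply: injective_projections; vec; field.
by rewrite addrAC subrr add0r enormZ n2; lra.
Qed.

(** There are infinitely many pairs of lifts on the torus. Up to a common translation the pairs that
    nearly touch differ by bounded periods, so if the gaps tended to 0 a single pair would recur
    along [U] and be at distance at most 2. *)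
Lemma scatterer_gap : exists2 d : R, 0 < d & forall i j l l', lattice X l -> lattice X l' ->
  (i, l) <> (j, l') -> 2 + d <= enorm (c i + l - (c j + l')).
Proof.
have [U [UU Uoo]] := @free_ultrafilter.
suff [d d0 H] : exists2 d : R, 0 < d & forall i j l, lattice X l -> (i, l) <> (j, 0) ->
    2 + d <= enorm (c i + l - c j).
  exists d => // i j l l' hl hl' ne.
  rewrite (_ : c i + l - (c j + l') = c i + (l - l') - c j); last by vecring.
  apply: H; first exact: latticeB.
  move=> h; have ij : i = j := congr1 fst h.
  have ll : l - l' = 0 := congr1 snd h.
  by apply: ne; rewrite ij (subr0_eq ll).
apply: contrapT => no.
have ex n : exists z : 'I_m.+1 * 'I_m.+1 * plane R,
    [/\ lattice X z.2, (z.1.1, z.2) <> (z.1.2, 0) &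
      enorm (c z.1.1 + z.2 - c z.1.2) < 2 + n.+1%:R^-1].
  apply: contrapT => h; apply: no; exists n.+1%:R^-1; first by rewrite invr_gt0.
  move=> i j l hl ne; rewrite leNgt; apply/negP => lt; apply: h.
  by exists (i, j, l).
have [z zP] := choice ex.
have [i Ui] := ultra_fin UU (fun n => (z n).1.1).
have [j Uj] := ultra_fin UU (fun n => (z n).1.2).
have [l hl Ul] : exists2 l, lattice X l & U [set n | (z n).2 = l].
  apply: (lattice_ultra_const (B := 3 + enorm (c i) + enorm (c j))); first exact: bs.1.
  apply: filterS (ultraI UU Ui Uj) => n [/= zi zj]; have [h1 _ h3] := zP n; split=> //.
  rewrite zi zj in h3.
  have -> : (z n).2 = (c i + (z n).2 - c j) - (c i - c j) by vecring.
  have := enormB (c i + (z n).2 - c j) (c i - c j); have := enormB (c i) (c j).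
  have r1 : n.+1%:R^-1 <= 1 :> R by rewrite invf_le1 // ler1n.
  move: h3 r1; set r : R := n.+1%:R^-1; move: r => r; clear; move=> h1 h2 h3 h4. lra.
have UA := ultraI UU Ui (ultraI UU Uj Ul).
have [n [/= zi [zj zl]]] := ultra_inh UU UA.
have [_ ne _] := zP n; rewrite zi zj zl in ne.
have := centers_dist hl ne; rewrite ltNge => /negP; apply.
apply: (@lim_le _ U _ (fun=> enorm (c i + l - c j)) (fun n => 2 + n.+1%:R^-1)).
- exact: cvg_cst.
- rewrite -[X in _ --> X]addr0; apply: cvgD; first exact: cvg_cst.
  by apply: (@ulim_eventually _ U) => //; apply: cvg_harmonic.
- apply: filterS UA => k [/= ki [kj kl]]; have [_ _] := zP k.
  by rewrite ki kj kl => /ltW.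
Qed.

End Gap.

(** * Moving scatterer 0 *)

(* The k-th collision is with the disk of center [c (s k) + lk k], where [lk k] is a
   period; [ctr g k] is this center after scatterer 0 has moved by [g *: e], and
   [2 * ell] is the gap between the scatterers, halved to leave room for the motion. *)
Section Motion.
Context {R : realType} (X : ambient R) (m : nat) (c : 'I_m.+1 -> plane R).
Context (bs : billiard_system X c) (ell : R) (ell0 : 0 < ell).
Context (gap : forall i j l l', lattice X l -> lattice X l' ->
  (i, l) <> (j, l') -> 2 + (ell + ell) <= enorm (c i + l - (c j + l'))).
Context (N : nat) (w e : plane R) (s : nat -> 'I_m.+1) (lk : nat -> plane R).
Context (N1 : (1 < N)%N) (wl : lattice X w) (s_per : forall k, s (k + N)%N = s k)
  (lkl : forall k, lattice X (lk k)) (lk_per : forall k, lk (k + N)%N = lk k + w)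
  (adj : forall k, (s k, lk k) <> (s k.+1, lk k.+1)) (e1 : enorm e = 1).
Implicit Types (g t : R) (i j : 'I_m.+1) (l : plane R) (x : nat -> plane R).

Definition cen g i l : plane R := c i + l + (if i == ord0 then g else 0) *: e.
Definition ek k : plane R := if s k == ord0 then e else 0.
Definition ctr g k : plane R := (c (s k) + lk k) + g *: ek k.
Definition moved g := move_scatterer c ord0 (c ord0 + g *: e).

Lemma movedE g i l : moved g i + l = cen g i l.
Proof.
rewrite /moved /move_scatterer /cen; case: eqP => [->|_]; first by vecring.
by rewrite scale0r addr0.
Qed.

Lemma ctrE g k : ctr g k = cen g (s k) (lk k).
Proof. by rewrite /ctr /cen /ek; case: eqP => _; rewrite ?scaler0 ?scale0r. Qed.

Lemma ek_per k : ek (k + N)%N = ek k.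
Proof. by rewrite /ek s_per. Qed.

Lemma ctr_per g : periodic_lift N w (ctr g).
Proof. by move=> k; rewrite /ctr ek_per s_per lk_per; vecring. Qed.

Lemma cen_gap g i j l l' : 0 <= g <= ell -> lattice X l -> lattice X l' ->
  (i, l) <> (j, l') -> 2 + ell <= enorm (cen g i l - cen g j l').
Proof.
move=> /andP[g0 gl] hl hl' ne; have := gap hl hl' ne.
set u := c i + l - (c j + l').
have -> : cen g i l - cen g j l' =
  u + ((if i == ord0 then g else 0) - (if j == ord0 then g else 0)) *: e.
  by rewrite /cen /u; vecring.
move=> h; apply: le_trans (enormD_ge _ _); rewrite enormZ e1 mulr1.
suff : `|(if i == ord0 then g else 0) - (if j == ord0 then g else 0)| <= ell.
  by move: h; move=> h1 h2; lra.
by case: ifP; case: ifP => _ _; rewrite ?subrr ?subr0 ?sub0r ?normrN ?normr0 ?ger0_norm ?(ltW ell0).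
Qed.

Lemma ctr_spaced g : 0 <= g <= ell -> spaced ell (ctr g).
Proof. by move=> g01 k; rewrite !ctrE; apply: cen_gap => //; apply/nesym/adj. Qed.

Lemma disks_disjoint g i j l l' z : 0 <= g <= ell -> lattice X l -> lattice X l' ->
  enorm (z - cen g i l) <= 1 -> enorm (z - cen g j l') <= 1 -> (i, l) = (j, l').
Proof.
move=> g01 hl hl' z1 z2; apply: contrapT => ne.
have := cen_gap g01 hl hl' ne.
rewrite (_ : cen g i l - cen g j l' = (z - cen g j l') - (z - cen g i l)); last by vecring.
have := enormB (z - cen g j l') (z - cen g i l).
by move: ell0 z1 z2; move=> *; lra.
Qed.

Lemma moved_system g : 0 <= g <= ell -> billiard_system X (moved g).
Proof.
move=> g01; split; first exact: bs.1.
move=> i j l hl ne; rewrite -subset0 => z [].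
rewrite /closed_disk /= -[moved g j]addr0 !movedE => z1 z2.
by apply: ne; apply: (disks_disjoint g01 hl (lattice0 X) z1 z2).
Qed.

(** [wgood] is preserved by limits and [sgood] is open among minimizers. A segment touches the disks
    at its own two ends, so these are left to the one-sided conditions of [weakly_outside]. *)
Definition wgood g x := weakly_outside (ctr g) x /\
  forall k i l, lattice X l -> (i, l) <> (s k, lk k) -> (i, l) <> (s k.+1, lk k.+1) ->
  forall t, 0 <= t <= 1 -> 1 <= enorm (x k + t *: step x k - cen g i l).

Definition far g x k := forall i l, lattice X l -> (i, l) <> (s k, lk k) ->
  (i, l) <> (s k.+1, lk k.+1) ->
  forall t, 0 <= t <= 1 -> 1 < enorm (x k + t *: step x k - cen g i l).

Definition sgood g x := strictly_outside (ctr g) x /\ forall k, far g x k.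

Lemma sgood_wgood g x : sgood g x -> wgood g x.
Proof.
move=> [so fr]; split=> [k|k i l hl n1 n2 t t01]; last exact/ltW/fr.
by have [h1 h2 h3] := so k; split=> //; exact: ltW.
Qed.

Lemma wgood_table g x k i l t : wgood g x -> lattice X l -> 0 <= t <= 1 ->
  1 <= enorm (x k + t *: step x k - cen g i l).
Proof.
move=> [wo fr] hl t01; have /andP[t0 t1] := t01.
have [h|n1] := pselect ((i, l) = (s k, lk k)).
  have -> : cen g i l = ctr g k by rewrite ctrE (congr1 fst h : i = _) (congr1 snd h : l = _).
  have [h1 h2 _] := wo k; rewrite addrAC; exact: ray_outside.
have [h|n2] := pselect ((i, l) = (s k.+1, lk k.+1)); last exact: fr.
have -> : cen g i l = ctr g k.+1 by rewrite ctrE (congr1 fst h : i = _) (congr1 snd h : l = _).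
have [_ _ h3] := wo k; have [h1 _ _] := wo k.+1.
rewrite (_ : _ - _ = (x k.+1 - ctr g k.+1) + (1 - t) *: (- step x k)); last first.
  by rewrite /step; vecring.
by apply: ray_outside; rewrite ?subr_ge0 // dotNl oppr_ge0.
Qed.

Lemma sgood_interior g x k i l t : sgood g x -> lattice X l -> 0 < t < 1 ->
  1 < enorm (x k + t *: step x k - cen g i l).
Proof.
move=> [wo fr] hl /andP[t0 t1].
have [h|n1] := pselect ((i, l) = (s k, lk k)).
  have -> : cen g i l = ctr g k by rewrite ctrE (congr1 fst h : i = _) (congr1 snd h : l = _).
  have [h1 h2 _] := wo k; rewrite addrAC; exact: ray_strictly_outside.
have [h|n2] := pselect ((i, l) = (s k.+1, lk k.+1)); last by apply: fr; rewrite ?ltW.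
have -> : cen g i l = ctr g k.+1 by rewrite ctrE (congr1 fst h : i = _) (congr1 snd h : l = _).
have [_ _ h3] := wo k; have [h1 _ _] := wo k.+1.
rewrite (_ : _ - _ = (x k.+1 - ctr g k.+1) + (1 - t) *: (- step x k)); last first.
  by rewrite /step; vecring.
by apply: ray_strictly_outside; rewrite ?subr_gt0 // dotNl oppr_gt0.
Qed.

Lemma wgood_trajectory g x : 0 <= g <= ell -> minimizer N w (ctr g) x -> wgood g x ->
  periodic_trajectory X (moved g) N s x.
Proof.
move=> g01 xmin xg; have Ps := ctr_spaced g01; have Pp := ctr_per g.
split; [exact: ltnW|by exists w => //; exact: xmin.1.1|exact: s_per|split].
- move=> k; exists (ctr g k); last by case: (xg.1 k).
  by exists (lk k) => //; rewrite movedE ctrE.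
- move=> k xk; have := step_gt0 ell0 Ps xmin k.
  by rewrite /step -xk subrr enorm0 ltxx.
- move=> k _ [t [t01 ->]] [i _ [p [l hl ->]]]; rewrite movedE /open_disk /=.
  by rewrite ltNge (wgood_table k i xg hl t01).
- move=> k p [l hl ->]; rewrite movedE => pc.
  have [xc _ _] := xg.1 k.+1.
  have E : cen g (s k.+1) l = ctr g k.+1.
    have := @disks_disjoint g (s k.+1) (s k.+1) l (lk k.+1) (x k.+1) g01 hl (lkl _).
    rewrite -ctrE xc pc lexx => /(_ isT isT) h.
    by rewrite ctrE (congr1 snd h : l = _).
  rewrite E /specular.
  have v := velocity_refl N1 ell0 Pp Ps xmin k.
  suff E2 : enorm (velocity x k.+1 - velocity x k) =
      - (2 * dot (velocity x k) (x k.+1 - ctr g k.+1)).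
    by rewrite -[LHS](subrK (velocity x k)) v E2 scaleNr addrC.
  have n1 : dot (x k.+1 - ctr g k.+1) (x k.+1 - ctr g k.+1) = 1 by apply/enorm_eq1.
  have -> : enorm (velocity x k.+1 - velocity x k) =
      dot (velocity x k.+1) (x k.+1 - ctr g k.+1) - dot (velocity x k) (x k.+1 - ctr g k.+1).
    by rewrite -dotBl [in RHS]v dotZl n1 mulr1.
  (* If the velocity does not change, weak outsideness bounds its normal component from both sides
     by 0, and the reflection law holds trivially. *)
  have [vv|vv] := eqVneq (velocity x k.+1) (velocity x k); last first.
    by rewrite (specular_dot N1 ell0 Pp Ps xmin vv); ring.
  have [_ _ h1] := xg.1 k; have [_ h2 _] := xg.1 k.+1.
  have : dot (velocity x k) (x k.+1 - ctr g k.+1) = 0.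
    apply/eqP; rewrite eq_le; apply/andP; split.
      by rewrite leNgt (dot_velocity_gt0 ell0 Ps xmin) -leNgt.
    by rewrite -vv leNgt (dot_velocity_lt0 ell0 Ps xmin) -leNgt.
  by rewrite vv => ->; ring.
Qed.

Lemma sgood_listed g x : sgood g x -> all_collisions_listed X (moved g) x.
Proof.
move=> xg k i; rewrite -subset0 => _ [[t [t01 ->]]] [_ [l hl ->]].
rewrite movedE /circle /= => h.
by have := sgood_interior k i xg hl t01; rewrite h ltxx.
Qed.

(** Each inequality of [wgood] that is an equality is a tangency: at a vertex by definition, inside
    a segment because the line stays outside the disk on both sides of the contact. *)
Lemma wgood_singular g x : 0 <= g <= ell -> minimizer N w (ctr g) x -> wgood g x ->
  ~ singular X (moved g) x -> sgood g x.
Proof.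
move=> g01 xmin xg ns; have Ps := ctr_spaced g01.
have sp k := step_gt0 ell0 Ps xmin k.
have v1 k : enorm (velocity x k) = 1 := enorm_velocity ell0 Ps xmin k.
have sing k i l t : lattice X l -> 0 <= t <= 1 ->
    enorm (x k + t *: step x k - cen g i l) = 1 ->
    dot (step x k) (x k + t *: step x k - cen g i l) = 0 -> False.
  move=> hl t01 h1 h2; apply: ns; exists k, i, (cen g i l), (x k + t *: step x k); split.
  - by exists l => //; rewrite movedE.
  - exact: h1.
  - by exists t.
  - by apply: tangent_incidence => //; rewrite velocityE dot_udir h2 mul0r.
split=> [k|k i l hl n1 n2 t t01].
  have [h1 h2 h3] := xg.1 k; have [h1' _ _] := xg.1 k.+1; split=> //.
  - rewrite lt_neqAle h2 andbT; apply/eqP => h; apply: (sing k (s k) (lk k) 0) => //.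
    + by rewrite lexx ler01.
    + by rewrite scale0r addr0 -ctrE.
    + by rewrite scale0r addr0 -ctrE.
  - rewrite lt_neqAle h3 andbT; apply/eqP => h; apply: (sing k (s k.+1) (lk k.+1) 1) => //.
    + by rewrite lexx ler01.
    + by rewrite scale1r /step [x k + _]addrC subrK -ctrE.
    + by rewrite scale1r {2}/step [x k + _]addrC subrK -ctrE.
rewrite lt_neqAle (wgood_table k i xg hl t01) andbT; apply/eqP => h.
apply: (sing k i l t) => //.
(* Contact with a third disk cannot occur at an end of the segment, since that end already lies on
   another disk. *)
have tends z j l' : lattice X l' -> (i, l) <> (j, l') -> enorm (z - cen g j l') = 1 ->
    enorm (z - cen g i l) = 1 -> False.
  by move=> hl' ne z1 z2; apply: ne; apply: (@disks_disjoint g _ _ _ _ z) => //; rewrite ?z1 ?z2.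
have [c0 _ _] := xg.1 k; have [c1 _ _] := xg.1 k.+1.
have t0 : t <> 0.
  move=> t0; apply: (tends (x k) (s k) (lk k)) => //; first by rewrite -ctrE.
  by rewrite h t0 scale0r addr0.
have t1 : t <> 1.
  move=> t1; apply: (tends (x k.+1) (s k.+1) (lk k.+1)) => //; first by rewrite -ctrE.
  by rewrite h t1 scale1r /step [x k + _]addrC subrK.
have /andP[t0' t1'] := t01.
have tt0 : 0 < t by rewrite lt_neqAle t0' andbT; apply/eqP/nesym.
have tt1 : t < 1 by rewrite lt_neqAle t1' andbT; apply/eqP.
apply: (@interior_touch_dot0 _ _ _ (Num.min t (1 - t))) => //.
  by rewrite lt_min tt0 subr_gt0.
move=> z; rewrite le_min !ler_norml => /andP[/andP[z1 z2] /andP[z3 z4]].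
rewrite (_ : _ + _ = x k + (t + z) *: step x k - cen g i l); last by vecring.
apply: (wgood_table k i xg hl); apply/andP; move: z1 z2 z3 z4; move=> *; split; lra.
Qed.

(** * Closed and open conditions along sequences of orbits *)

Section MotionLimits.
Context (U : set_system nat) (UU : UltraFilter U).

Lemma cvg_cen g (y : nat -> R) i l : y @ U --> g -> vcvg U (fun n => cen (y n) i l) (cen g i l).
Proof.
move=> yg; apply: vcvgD; first exact: vcvg_cst.
by apply: vcvgZ; [case: ifP => _ //; exact: cvg_cst|exact: vcvg_cst].
Qed.

Lemma cvg_ctr g (y : nat -> R) k : y @ U --> g -> vcvg U (fun n => ctr (y n) k) (ctr g k).
Proof.
by move=> yg; apply: vcvgD; [exact: vcvg_cst|apply: vcvgZ => //; exact: vcvg_cst].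
Qed.

Lemma cvg_step x (xn : nat -> nat -> plane R) k : (forall k, vcvg U (fun n => xn n k) (x k)) ->
  vcvg U (fun n => step (xn n) k) (step x k).
Proof. by move=> h; apply: vcvgB. Qed.

Lemma wgood_lim g (y : nat -> R) x (xn : nat -> nat -> plane R) :
  y @ U --> g -> (forall k, vcvg U (fun n => xn n k) (x k)) ->
  (forall n, wgood (y n) (xn n)) -> wgood g x.
Proof.
move=> yg xx wg.
have hn k : vcvg U (fun n => xn n k - ctr (y n) k) (x k - ctr g k).
  by apply: vcvgB => //; exact: cvg_ctr.
have hs k : vcvg U (fun n => step (xn n) k) (step x k) by exact: cvg_step.
split=> [k|k i l hl n1 n2 t t01].
  split.
  - apply: (@cvg_real_unique _ U _ (fun n => enorm (xn n k - ctr (y n) k))); first exact: cvg_enorm.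
    rewrite (_ : (fun n => _) = fun=> 1); first exact: cvg_cst.
    by apply/funext => n; have [-> _ _] := (wg n).1 k.
  - apply: (@lim_le _ U _ (fun=> 0) (fun n => dot (step (xn n) k) (xn n k - ctr (y n) k))).
    + exact: cvg_cst.
    + exact: cvg_dot.
    + by apply: filterE => n; have [_ h _] := (wg n).1 k; exact: h.
  - apply: (@lim_le _ U _ (fun n => dot (step (xn n) k) (xn n k.+1 - ctr (y n) k.+1)) (fun=> 0)).
    + exact: cvg_dot.
    + exact: cvg_cst.
    + by apply: filterE => n; have [_ _ h] := (wg n).1 k; exact: h.
apply: (@lim_le _ U _ (fun=> 1) (fun n => enorm (xn n k + t *: step (xn n) k - cen (y n) i l))).
- exact: cvg_cst.
- apply: cvg_enorm; apply: vcvgB; last exact: cvg_cen.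
  by apply: vcvgD; [exact: xx|apply: vcvgZ; [exact: cvg_cst|exact: hs]].
- by apply: filterE => n; exact: (wg n).2.
Qed.

Lemma far_per g x k : periodic_lift N w x -> far g x (k + N)%N <-> far g x k.
Proof.
move=> xp; have cenw i l u : cen g i (l + u) = cen g i l + u by rewrite /cen; vecring.
split=> fr i l hl n1 n2 t t01.
  have := fr i (l + w) (latticeD hl wl); rewrite -addSn !s_per !lk_per => h.
  have := h _ _ t t01; rewrite cenw xp (step_per k xp) => {}h.
  rewrite (_ : _ - _ = x k + w + t *: step x k - (cen g i l + w)); last by vecring.
  apply: h => h; [apply: n1|apply: n2]; rewrite (congr1 fst h : i = _); congr pair;
    exact: (addIr w (congr1 snd h : l + w = _)).
have := fr i (l - w) (latticeB hl wl); rewrite cenw => h.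
rewrite xp (step_per k xp).
rewrite (_ : _ - _ = x k + t *: step x k - (cen g i l - w)); last by vecring.
have lw u : l - w = u -> l = u + w by move=> <-; rewrite subrK.
apply: h => // h; [apply: n1|apply: n2]; rewrite -?addSn s_per lk_per (congr1 fst h : i = _);
  congr pair; exact: (lw _ (congr1 snd h : l - w = _)).
Qed.

(** Compactness over all scatterers and times: if violations occurred for [U]-almost all [n], their
    scatterer and period would be constant along [U] and their time would converge, giving a
    violation in the limit. *)
Lemma far_open g (y : nat -> R) x (xn : nat -> nat -> plane R) k :
  (forall n, 0 <= y n <= ell) -> y @ U --> g -> (forall k, vcvg U (fun n => xn n k) (x k)) ->
  (forall n, feasible N w (ctr (y n)) (xn n)) -> far g x k ->
  U [set n | far (y n) (xn n) k].
Proof.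
move=> y01 yg xx xf fr; apply: contrapT => /(ultraC UU) UA.
set A := ~` _ in UA.
have ex n : exists z : 'I_m.+1 * plane R * R, A n ->
   [/\ lattice X z.1.2, z.1 <> (s k, lk k), z.1 <> (s k.+1, lk k.+1), 0 <= z.2 <= 1 &
     enorm (xn n k + z.2 *: step (xn n) k - cen (y n) z.1.1 z.1.2) <= 1].
  (* The triple [(ord0, 0, 0)] is a default for the indices without a violation. *)
  have [An|nA] := pselect (A n); last by exists (ord0, 0, 0).
  apply: contrapT => h; apply: An => i l hl n1 n2 t t01.
  by rewrite ltNge; apply/negP => h1; apply: h; exists (i, l, t).
have [z zP] := choice ex.
have [i Ui] := ultra_fin UU (fun n => (z n).1.1).
have xb n k' : enorm (xn n k') <= enorm (c (s k') + lk k') + ell + 1.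
  have := (xf n).2 k'; have /andP[y0 yl] := y01 n.
  rewrite {2}(_ : xn n k' = (xn n k' - ctr (y n) k') + (c (s k') + lk k') + (y n *: ek k')).
    have := enormD (xn n k' - ctr (y n) k' + (c (s k') + lk k')) (y n *: ek k').
    have := enormD (xn n k' - ctr (y n) k') (c (s k') + lk k').
    have : enorm (y n *: ek k') <= ell.
      rewrite enormZ ger0_norm // /ek; case: ifP => _; rewrite ?e1 ?mulr1 //.
      by rewrite enorm0 mulr0 ltW.
    by move=> h1 h2 h3 h4; lra.
  by rewrite /ctr; vecring.
pose B := enorm (c (s k) + lk k) + enorm (c (s k.+1) + lk k.+1) + ell + ell + ell + 3 + enorm (c i).
have [l hl Ul] : exists2 l, lattice X l & U [set n | (z n).1.2 = l].
  apply: (lattice_ultra_const (B := B)); first exact: bs.1.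
  apply: filterS (ultraI UU UA Ui) => n [/zP [h1 _ _ /andP[t0 t1] h2] /= zi]; split=> //.
  rewrite zi in h2; move: t0 t1 h2; set t := (z n).2; set l := (z n).1.2 => t0 t1 h2.
  have -> : l = (xn n k + t *: step (xn n) k) -
      (xn n k + t *: step (xn n) k - cen (y n) i l) - (c i + (if i == ord0 then y n else 0) *: e).
    by rewrite /cen; vecring.
  set u := _ - cen _ _ _ in h2 *; set q := _ + _ *: e.
  have q1 : enorm q <= enorm (c i) + ell.
    apply: (le_trans (enormD _ _)); rewrite lerD2l enormZ e1 mulr1.
    have /andP[y0 yl] := y01 n.
    by case: ifP => _; rewrite ?normr0 ?(ltW ell0) ?ger0_norm.
  have q2 : enorm (xn n k + t *: step (xn n) k) <= enorm (xn n k) + enorm (xn n k.+1).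
    rewrite (_ : _ + _ *: _ = (1 - t) *: xn n k + t *: xn n k.+1); last by rewrite /step; vecring.
    apply: (le_trans (enormD _ _)); rewrite !enormZ !ger0_norm ?subr_ge0 //.
    by have := enorm_ge0 (xn n k); have := enorm_ge0 (xn n k.+1); move=> *; nra.
  have := enormB (xn n k + t *: step (xn n) k - u) q.
  have := enormB (xn n k + t *: step (xn n) k) u.
  have := xb n k; have := xb n k.+1; rewrite /B.
  by move=> h3 h4 h5 h6; lra.
have [t Ut] : exists t : R, (z n).2 @[n --> U] --> t.
  apply: (ulim_bounded (B := 1)); apply: filterS UA => n /zP [_ _ _ /andP[t0 t1] _] /=.
  by rewrite ger0_norm.
have UB := ultraI UU UA (ultraI UU Ui Ul).
have [n [An [/= ni nl]]] := ultra_inh UU UB.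
have [_ n1 n2 _ _] := zP n An.
have zn : (z n).1 = (i, l) by rewrite -ni -nl; case: (z n).1.
rewrite zn in n1 n2.
have t01 : 0 <= t <= 1.
  apply/andP; split.
    apply: (@lim_le _ U _ (fun=> 0) (fun n => (z n).2)); [exact: cvg_cst|exact: Ut|].
    by apply: filterS UA => j /zP [_ _ _ /andP[]].
  apply: (@lim_le _ U _ (fun n => (z n).2) (fun=> 1)); [exact: Ut|exact: cvg_cst|].
  by apply: filterS UA => j /zP [_ _ _ /andP[]].
have := fr i l hl n1 n2 t t01; rewrite ltNge => /negP; apply.
apply: (@lim_le _ U _ (fun n => enorm (xn n k + (z n).2 *: step (xn n) k - cen (y n) i l))
  (fun=> 1)).
- apply: cvg_enorm; apply: vcvgB; last exact: cvg_cen.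
  by apply: vcvgD; [exact: xx|apply: vcvgZ; [exact: Ut|exact: cvg_step]].
- exact: cvg_cst.
- by apply: filterS UB => j [/zP [_ _ _ _ +] [/= ji jl]]; rewrite ji jl.
Qed.

Lemma cvg_velocity x (xn : nat -> nat -> plane R) k : 0 < enorm (step x k) ->
  (forall k, vcvg U (fun n => xn n k) (x k)) ->
  vcvg U (fun n => velocity (xn n) k) (velocity x k).
Proof. by move=> x0 xx; apply: vcvg_udir => //; exact: cvg_step. Qed.

Lemma sgood_open g (y : nat -> R) x (xn : nat -> nat -> plane R) :
  0 <= g <= ell -> (forall n, 0 <= y n <= ell) -> y @ U --> g ->
  (forall k, vcvg U (fun n => xn n k) (x k)) -> minimizer N w (ctr g) x ->
  (forall n, minimizer N w (ctr (y n)) (xn n)) -> sgood g x ->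
  U [set n | sgood (y n) (xn n)].
Proof.
move=> g01 y01 yg xx xmin xnmin [so fr].
have N0 := ltnW N1; have Ps := ctr_spaced g01; have Pp := ctr_per g.
have xnp n := (xnmin n).1.1.
pose out n k := [/\ enorm (xn n k - ctr (y n) k) = 1,
  0 < dot (step (xn n) k) (xn n k - ctr (y n) k) &
  dot (step (xn n) k) (xn n k.+1 - ctr (y n) k.+1) < 0].
have dper n k : xn n (k + N)%N - ctr (y n) (k + N)%N = xn n k - ctr (y n) k.
  by rewrite xnp ctr_per; vecring.
have outp n k : out n (k + N)%N = out n k.
  by rewrite /out -addSn !dper (step_per k (xnp n)).
have farp n k : far (y n) (xn n) (k + N)%N = far (y n) (xn n) k.
  by apply: propext; exact: far_per.
have hn k : vcvg U (fun n => xn n k - ctr (y n) k) (x k - ctr g k).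
  by apply: vcvgB => //; exact: cvg_ctr.
have hs k : vcvg U (fun n => step (xn n) k) (step x k) by exact: cvg_step.
(* A turn of the limit orbit persists nearby, and a minimizer turns only where its vertex is on the
   circle. The flight arriving at [k] is taken one period later, as [k + N.-1], because [k] may be
   0. *)
have Uc k : U [set n | enorm (xn n k - ctr (y n) k) = 1].
  have vv := outside_velocity_neq ell0 Ps xmin (k + N.-1) so.
  have vl k' : vcvg U (fun n => velocity (xn n) k') (velocity x k').
    by apply: cvg_velocity => //; exact: step_gt0 ell0 Ps xmin k'.
  have lim : enorm (velocity (xn n) (k + N.-1).+1 - velocity (xn n) (k + N.-1)%N) @[n --> U] -->
     enorm (velocity x (k + N.-1).+1 - velocity x (k + N.-1)%N).
    by apply: cvg_enorm; apply: vcvgB; exact: vl.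
  have pos : 0 < enorm (velocity x (k + N.-1).+1 - velocity x (k + N.-1)%N).
    rewrite lt_neqAle enorm_ge0 andbT eq_sym; apply: contra vv => /eqP/enorm_eq0/eqP.
    by rewrite subr_eq0.
  apply: filterS (cvg_gt lim pos) => n /= h.
  rewrite -dper; have <- : (k + N.-1).+1 = (k + N)%N by lia.
  apply: (velocity_refl_circle N1 ell0 (ctr_per (y n)) (ctr_spaced (y01 n)) (xnmin n)).
  by apply/eqP => E; move: h; rewrite E subrr enorm0 ltxx.
have U1 k : U [set n | out n k].
  have [_ h2 h3] := so k.
  have l2 : dot (step (xn n) k) (xn n k - ctr (y n) k) @[n --> U] -->
      dot (step x k) (x k - ctr g k).
    exact: cvg_dot.
  have l3 : dot (step (xn n) k) (xn n k.+1 - ctr (y n) k.+1) @[n --> U] -->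
      dot (step x k) (x k.+1 - ctr g k.+1) by exact: cvg_dot.
  by apply: filterS (ultraI UU (Uc k) (ultraI UU (cvg_gt l2 h2) (cvg_lt l3 h3))) => n [? []].
have U2 k : U [set n | far (y n) (xn n) k].
  by apply: (far_open y01 yg xx _ (fr k)) => n; exact: (xnmin n).1.
have UA : U [set n | forall k : 'I_N, out n k /\ far (y n) (xn n) k].
  by apply: filter_forall => k; exact: (ultraI UU (U1 k) (U2 k)).
apply: filterS UA => n h; split=> k; have [i iN E] := periodic_window 0 k N0.
  by have := E _ (out n) (outp n); rewrite add0n /out => ->; exact: (h (Ordinal iN)).1.
by rewrite (E _ (far (y n) (xn n)) (farp n)) add0n; exact: (h (Ordinal iN)).2.
Qed.

End MotionLimits.

Context (Q : R -> nat -> plane R) (Qmin : forall g, minimizer N w (ctr g) (Q g)).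

Lemma minimizer_ulim U (UU : UltraFilter U) g (y : nat -> R) :
  (forall n, 0 <= y n <= ell) -> y @ U --> g ->
  exists2 x, minimizer N w (ctr g) x & forall k, vcvg U (fun n => Q (y n) k) (x k).
Proof.
move=> y01 yg.
have ex k : exists l, vcvg U (fun n => Q (y n) k) l.
  apply: (vulim_bounded (B := enorm (c (s k) + lk k) + ell + 1)); apply: filterE; move=> n /=.
  have := (Qmin (y n)).1.2 k; have /andP[y0 yl] := y01 n.
  have -> : Q (y n) k = (Q (y n) k - ctr (y n) k) + (c (s k) + lk k) + (y n *: ek k).
    by rewrite /ctr; vecring.
  have := enormD (Q (y n) k - ctr (y n) k + (c (s k) + lk k)) (y n *: ek k).
  have := enormD (Q (y n) k - ctr (y n) k) (c (s k) + lk k).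
  have : enorm (y n *: ek k) <= ell.
    rewrite enormZ ger0_norm // /ek; case: ifP => _; rewrite ?e1 ?mulr1 //.
    by rewrite enorm0 mulr0 ltW.
  by rewrite (_ : _ + _ + _ - _ = Q (y n) k - ctr (y n) k); [move=> *; lra|rewrite /ctr; vecring].
have [x xP] := choice ex; exists x => //.
apply: (minimizer_lim xP (fun k => cvg_ctr UU k yg)) => [|n|n]; [exact: ctr_per|exact: ctr_per|].
exact: Qmin.
Qed.

(** [Q] is an arbitrary choice of minimizers. Limits of minimizers are minimizers, and uniqueness,
    which requires one genuine reflection, identifies the limit with [Q g]. *)
Lemma orbit_cvg U (UU : UltraFilter U) g (y : nat -> R) k0 : 0 <= g <= ell ->
  (forall n, 0 <= y n <= ell) -> y @ U --> g -> wgood g (Q g) ->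
  velocity (Q g) k0.+1 != velocity (Q g) k0 ->
  forall k, vcvg U (fun n => Q (y n) k) (Q g k).
Proof.
move=> g01 y01 yg wg vv k; have [x xmin xl] := minimizer_ulim UU y01 yg.
rewrite -(minimizer_unique' N1 ell0 (ctr_per g) (ctr_spaced g01) (Qmin g) vv wg.1 xmin k).
exact: xl.
Qed.

(* Coordinates of the center [cen g ord0 l] relative to the line of the k-th segment:
   signed distance to the line, and position of the orthogonal projection. *)
Definition offset sg l k g : R :=
  sg * dot (cen g ord0 l - Q g k) (perp (velocity (Q g) k)).
Definition foot l k g : R := dot (cen g ord0 l - Q g k) (velocity (Q g) k).

Lemma endpoint_dist g l k : 0 <= g <= ell -> lattice X l -> s k <> ord0 ->
  1 + ell <= enorm (cen g ord0 l - Q g k).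
Proof.
move=> g01 hl sk; have := @cen_gap g ord0 (s k) l (lk k) g01 hl (lkl k).
move=> /(_ (fun h => sk (esym (congr1 fst h : ord0 = s k)))).
have := enormB_ge (cen g ord0 l - ctr g k) (Q g k - ctr g k).
rewrite (_ : _ - _ - (_ - _) = cen g ord0 l - Q g k); last by vecring.
by have := (Qmin g).1.2 k; rewrite -ctrE => h1 h2 h3; lra.
Qed.

Lemma foot_offset_sq sg l k g : 0 <= g <= ell -> sg ^+ 2 = 1 ->
  enorm (cen g ord0 l - Q g k) ^+ 2 = foot l k g ^+ 2 + offset sg l k g ^+ 2.
Proof.
move=> g01 sg1; have v1 := enorm_velocity ell0 (ctr_spaced g01) (Qmin g) k.
have := dot_perp_sq (velocity (Q g) k) (cen g ord0 l - Q g k).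
rewrite -!enorm_sq v1 expr1n mul1r /foot /offset exprMn sg1 mul1r => <-.
by congr (_ ^+ 2 + _ ^+ 2); rewrite dotC.
Qed.

(** With the foot at an end of the segment, the offset would be the distance from the center to that
    end. But the ends lie on other scatterers, at distance at least [1 + ell]. *)
Lemma foot_interior sg l k g : 0 <= g <= ell -> sg ^+ 2 = 1 -> lattice X l ->
  s k <> ord0 -> s k.+1 <> ord0 -> 0 < offset sg l k g < 1 + ell ->
  0 <= foot l k g <= enorm (step (Q g) k) -> 0 < foot l k g < enorm (step (Q g) k).
Proof.
move=> g01 sg1 hl sk sk1 /andP[p0 p1] /andP[f0 f1].
have osq : offset sg l k g ^+ 2 < (1 + ell) ^+ 2.
  by rewrite ltr_pXn2r // nnegrE ?ltW // addr_gt0.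
have far_end z : 1 + ell <= enorm z -> (1 + ell) ^+ 2 <= enorm z ^+ 2.
  by move=> h; rewrite ler_pXn2r // nnegrE ?enorm_ge0 // ltW // addr_gt0.
rewrite !lt_neqAle f0 f1 !andbT; apply/andP; split; apply/eqP => E.
  have := far_end _ (endpoint_dist g01 hl sk).
  by rewrite (foot_offset_sq l k g01 sg1) -E expr0n add0r; lra.
have := far_end _ (endpoint_dist g01 hl sk1).
have sE := velocity_step ell0 (ctr_spaced g01) (Qmin g) k.
have v1 := enorm_velocity ell0 (ctr_spaced g01) (Qmin g) k.
have -> : cen g ord0 l - Q g k.+1 = (cen g ord0 l - Q g k) - foot l k g *: velocity (Q g) k.
  by rewrite E -sE /step; vecring.
rewrite enorm_sq; set r := cen _ _ _ - _; set v := velocity _ _; set f := foot l k g.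
have -> : dot (r - f *: v) (r - f *: v) = dot r r - 2 * f * dot r v + f ^+ 2 * dot v v by vring.
rewrite -/(foot l k g) -/f -!enorm_sq v1 (foot_offset_sq l k g01 sg1) -/f => h; lra.
Qed.

Lemma offset_ge1 sg l k g : 0 <= g <= ell -> sg ^+ 2 = 1 -> lattice X l ->
  wgood g (Q g) -> 0 <= foot l k g <= enorm (step (Q g) k) -> 0 <= offset sg l k g ->
  1 <= offset sg l k g.
Proof.
move=> g01 sg1 hl wg /andP[f0 f1] p0.
have sp := step_gt0 ell0 (ctr_spaced g01) (Qmin g) k.
have sE := velocity_step ell0 (ctr_spaced g01) (Qmin g) k.
have v1 := enorm_velocity ell0 (ctr_spaced g01) (Qmin g) k.
have := @wgood_table g (Q g) k ord0 l (foot l k g / enorm (step (Q g) k)) wg hl.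
rewrite divr_ge0 ?(ltW sp) // ler_pdivrMr // mul1r f1 => /(_ isT).
have -> : (foot l k g / enorm (step (Q g) k)) *: step (Q g) k = foot l k g *: velocity (Q g) k.
  by rewrite velocityE scalerA.
rewrite enorm_dist.
have -> : cen g ord0 l - (Q g k + foot l k g *: velocity (Q g) k) =
   dot (perp (velocity (Q g) k)) (cen g ord0 l - Q g k) *: perp (velocity (Q g) k).
  rewrite opprD addrA {1}(decomp (cen g ord0 l - Q g k) v1) /foot.
  by rewrite [dot (velocity _ _) _]dotC addrAC subrr add0r.
rewrite enormZ enorm_perp v1 mulr1.
have -> : `|dot (perp (velocity (Q g) k)) (cen g ord0 l - Q g k)| = `|offset sg l k g|.
  rewrite /offset normrM [dot (perp _) _]dotC.
  by rewrite (norm1_of_sqr sg1) mul1r.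
by rewrite ger0_norm.
Qed.

(** If the foot were beyond an end, that end would be the nearest point of the segment, although
    some point is closer than [1 + ell] and the ends are not. *)
Lemma foot_between l k g t : 0 <= g <= ell -> lattice X l ->
  s k <> ord0 -> s k.+1 <> ord0 -> 0 <= t <= 1 ->
  enorm (Q g k + t *: step (Q g) k - cen g ord0 l) < 1 + ell ->
  0 <= foot l k g <= enorm (step (Q g) k).
Proof.
move=> g01 hl sk sk1 /andP[t0 t1] near.
have sp := step_gt0 ell0 (ctr_spaced g01) (Qmin g) k.
have sE := velocity_step ell0 (ctr_spaced g01) (Qmin g) k.
have v1 : dot (velocity (Q g) k) (velocity (Q g) k) = 1.
  by apply/enorm_eq1; exact: enorm_velocity ell0 (ctr_spaced g01) (Qmin g) k.
set L := enorm (step (Q g) k) in sp sE *; set v := velocity (Q g) k in sE v1.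
have contra z : 1 + ell <= enorm z ->
    dot z z <= enorm (Q g k + t *: step (Q g) k - cen g ord0 l) ^+ 2 -> False.
  move=> h1; rewrite -enorm_sq ler_pXn2r ?nnegrE ?enorm_ge0 // => h2.
  by have := le_lt_trans (le_trans h1 h2) near; rewrite ltxx.
have E f : foot l k g = f ->
    enorm (Q g k + t *: step (Q g) k - cen g ord0 l) ^+ 2 =
    dot (cen g ord0 l - Q g k) (cen g ord0 l - Q g k) - 2 * t * L * f + t ^+ 2 * L ^+ 2.
  move=> <-; rewrite enorm_sq sE /foot -/v; set r := cen _ _ _ - _.
  have -> : Q g k + t *: (L *: v) - cen g ord0 l = (t * L) *: v - r by rewrite /r; vecring.
  transitivity (dot r r - 2 * t * L * dot r v + t ^+ 2 * L ^+ 2 * dot v v); first by vring.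
  by rewrite v1 mulr1.
apply/andP; split; rewrite leNgt; apply/negP => f0.
  apply: (contra _ (endpoint_dist g01 hl sk)); rewrite (E _ erefl).
  have h1 : 0 <= t * L * - foot l k g.
    by apply: mulr_ge0; [apply: mulr_ge0 => //; exact: ltW|rewrite oppr_ge0 ltW].
  have h2 : 0 <= t ^+ 2 * L ^+ 2 by rewrite mulr_ge0 // sqr_ge0.
  by lra.
apply: (contra _ (endpoint_dist g01 hl sk1)); rewrite (E _ erefl).
have -> : cen g ord0 l - Q g k.+1 = (cen g ord0 l - Q g k) - L *: v.
  by rewrite -sE /step; vecring.
have -> : dot (cen g ord0 l - Q g k - L *: v) (cen g ord0 l - Q g k - L *: v) =
   dot (cen g ord0 l - Q g k) (cen g ord0 l - Q g k) - 2 * L * foot l k g + L ^+ 2.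
  rewrite /foot -/v; set r := cen _ _ _ - _.
  transitivity (dot r r - 2 * L * dot r v + L ^+ 2 * dot v v); first by vring.
  by rewrite v1 mulr1.
have h : 0 <= L * (1 - t) * (2 * foot l k g - L * (1 + t)).
  apply: mulr_ge0; first by apply: mulr_ge0; [exact: ltW|rewrite subr_ge0].
  have : L * (1 + t) <= L * 2 by rewrite ler_pM2l //; lra.
  by lra.
by lra.
Qed.

Lemma offset_le sg l k g t : 0 <= g <= ell -> sg ^+ 2 = 1 ->
  offset sg l k g <= enorm (Q g k + t *: step (Q g) k - cen g ord0 l).
Proof.
move=> g01 sg1; have sE := velocity_step ell0 (ctr_spaced g01) (Qmin g) k.
have v1 := enorm_velocity ell0 (ctr_spaced g01) (Qmin g) k.
have -> : offset sg l k g = - (sg * dot (perp (velocity (Q g) k))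
    (Q g k + t *: step (Q g) k - cen g ord0 l)).
  by rewrite sE /offset; vring.
apply: (le_trans (ler_norm _)); rewrite normrN normrM (norm1_of_sqr sg1) mul1r.
by apply: (le_trans (cauchy_schwarz _ _)); rewrite enorm_perp v1 mul1r.
Qed.

Lemma cvg_foot_offset U (UU : UltraFilter U) sg l k g (y : nat -> R) : 0 <= g <= ell ->
  y @ U --> g -> (forall k, vcvg U (fun n => Q (y n) k) (Q g k)) ->
  [/\ offset sg l k (y n) @[n --> U] --> offset sg l k g,
      foot l k (y n) @[n --> U] --> foot l k g &
      enorm (step (Q (y n)) k) @[n --> U] --> enorm (step (Q g) k)].
Proof.
move=> g01 yg Qc; have sp := step_gt0 ell0 (ctr_spaced g01) (Qmin g) k.
have cv : vcvg U (fun n => velocity (Q (y n)) k) (velocity (Q g) k) by exact: cvg_velocity.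
have cc : vcvg U (fun n => cen (y n) ord0 l - Q (y n) k) (cen g ord0 l - Q g k).
  by apply: vcvgB => //; exact: cvg_cen.
split; last by apply: cvg_enorm; exact: cvg_step.
  by apply: cvgM; [exact: cvg_cst|apply: cvg_dot => //; exact: vcvg_perp].
exact: cvg_dot.
Qed.

(* [K] bounds the speed at which the velocities on the tracked flights rotate, and [eta]
   is a lower bound of the speed at which scatterer 0 approaches the segment [k1]. *)
Lemma reach_singular (k0 i1 : nat) l (sg K eta g1 : R) :
  s k0 = ord0 -> (forall i : nat, (0 < i < N)%N -> s (k0 + i)%N <> ord0) -> lattice X l ->
  (0 < i1)%N -> (i1.+1 < N)%N ->
  let k1 := (k0 + i1)%N in let v0 := velocity (Q 0) in
  sg ^+ 2 = 1 -> e = - sg *: perp (v0 k1) -> 0 < g1 <= ell ->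
  K = 3 / ell -> eta = ell / (3 * (1 + ell)) -> K * g1 <= eta ->
  enorm (v0 k0 + v0 (k0 + N.-1)%N) + 2 * K * g1 <= 1 ->
  sgood 0 (Q 0) -> 1 <= offset sg l k1 0 -> offset sg l k1 0 < 1 + ell ->
  offset sg l k1 0 < 1 + eta * g1 -> 0 < foot l k1 0 < enorm (step (Q 0) k1) ->
  exists x : R, [/\ 0 < x <= g1, forall g, 0 <= g < x -> sgood g (Q g),
    wgood x (Q x), ~ sgood x (Q x) & exists k, velocity (Q x) k.+1 != velocity (Q x) k].
Proof.
move=> sk0 skn0 hl i10 i1N k1 v0 sg1 eE /andP[g10 g1l] KE etaE Kg1 vsum good0
  off0 off0l off0g foot0.
have {}eE u : dot e u = - sg * dot (perp (v0 k1)) u by rewrite eE dotZl.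
(* Under [no] the invariant [Pr] below reaches [g1], where its upper bound for the offset drops
   below 1 and contradicts its lower bound. *)
apply: contrapT => no.
have N0 := ltnW N1.
have NE : (k0 + N.-1).+1 = (k0 + N)%N by rewrite -addnS prednK.
have K0 : 0 < K by rewrite KE divr_gt0.
have eta0 : 0 < eta by rewrite etaE divr_gt0 // mulr_gt0 // addr_gt0.
have ein g : 0 <= g <= g1 -> 0 <= g <= ell.
  by move=> /andP[-> h]; rewrite (le_trans h).
have sk1 : s k1 <> ord0 by apply: skn0; rewrite i10 ltnW.
have sk1S : s k1.+1 <> ord0 by rewrite -addnS; apply: skn0.
pose tracked k := [\/ k = k0, k = (k0 + N.-1)%N | k = k1].
pose near g (x : nat -> plane R) := forall k, tracked k -> enorm (velocity x k - v0 k) <= K * g.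
have near_sum g x : g <= g1 -> near g x ->
    enorm (velocity x k0 + velocity x (k0 + N.-1)%N) <= 1.
  move=> gg1 nr.
  have := nr k0 (Or31 _ _ erefl); have := nr (k0 + N.-1)%N (Or32 _ _ erefl).
  rewrite (_ : _ + velocity x _ = (v0 k0 + v0 (k0 + N.-1)%N) +
    ((velocity x k0 - v0 k0) + (velocity x (k0 + N.-1)%N - v0 (k0 + N.-1)%N))); last by vecring.
  have := enormD (v0 k0 + v0 (k0 + N.-1)%N) ((velocity x k0 - v0 k0) +
    (velocity x (k0 + N.-1)%N - v0 (k0 + N.-1)%N)).
  have := enormD (velocity x k0 - v0 k0) (velocity x (k0 + N.-1)%N - v0 (k0 + N.-1)%N).
  by move=> h1 h2 h3 h4; nra.
(* Without a reflection at scatterer 0 the two velocities would add up to length 2. This reflection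
   supplies the uniqueness of the minimizer. *)
have neq g x : 0 <= g <= ell -> minimizer N w (ctr g) x ->
    enorm (velocity x k0 + velocity x (k0 + N.-1)%N) <= 1 ->
    velocity x (k0 + N.-1).+1 != velocity x (k0 + N.-1)%N.
  move=> g01 xmin h; apply/eqP; rewrite NE.
  rewrite (velocity_per k0 xmin.1.1) => E.
  move: h; rewrite -E (_ : _ + _ = 2 *: velocity x k0); last by vecring.
  rewrite enormZ (enorm_velocity ell0 (ctr_spaced g01) xmin) mulr1.
  by rewrite ger0_norm // leNgt ltr1n.
pose Pr g := [/\ sgood g (Q g), near g (Q g), 1 <= offset sg l k1 g,
  offset sg l k1 g <= offset sg l k1 0 - eta * g &
  0 < foot l k1 g < enorm (step (Q g) k1)].
have Pr0 : Pr 0.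
  split=> //; last by rewrite mulr0 subr0.
  by move=> k _; rewrite subrr enorm0 mulr0.
have [U [UU Uoo]] := free_ultrafilter.
have Pclosed (x : R) : 0 < x <= g1 -> (forall y : R, 0 <= y < x -> Pr y) -> Pr x.
  move=> /andP[x0 xg1] below.
  have x01 : 0 <= x <= ell by rewrite ltW //= (le_trans xg1).
  pose y n := x - x * n.+1%:R^-1.
  have yx n : 0 <= y n < x.
    rewrite /y subr_ge0 ltrBlDr ltrDl mulr_gt0 ?invr_gt0 // andbT.
    by apply: ler_piMr; [exact: ltW|rewrite invf_le1 // ler1n].
  have y01 n : 0 <= y n <= ell.
    by have /andP[-> h] := yx n; rewrite (le_trans (ltW h)) //; case/andP: x01.
  have yU : y @ U --> x.
    apply: (@ulim_eventually _ U) => //.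
    have h : y @ \oo --> x - x * 0.
      by apply: cvgB; [exact: cvg_cst|apply: cvgM; [exact: cvg_cst|exact: cvg_harmonic]].
    by rewrite mulr0 subr0 in h.
  have Pry n := below (y n) (yx n).
  have [z zmin zl] := minimizer_ulim UU y01 yU.
  have spz k := step_gt0 ell0 (ctr_spaced x01) zmin k.
  have wz : wgood x z.
    by apply: (wgood_lim UU yU zl) => n; apply: sgood_wgood; case: (Pry n).
  have nz : near x z.
    move=> k kt; apply: (@lim_le _ U _ (fun n => enorm (velocity (Q (y n)) k - v0 k))
      (fun n => K * y n)).
    - by apply: cvg_enorm; apply: vcvgB; [exact: cvg_velocity|exact: vcvg_cst].
    - by apply: cvgM; [exact: cvg_cst|exact: yU].
    - by apply: filterE => n; have [_ h _ _ _] := Pry n; exact: h.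
  have vz := neq x z x01 zmin (near_sum x z xg1 nz).
  have Qz : Q x = z.
    apply/funext => k.
    exact: (minimizer_unique' N1 ell0 (ctr_per x) (ctr_spaced x01) zmin vz wz.1 (Qmin x)).
  rewrite -Qz in zl wz nz vz.
  have [lo lf ls] := cvg_foot_offset UU sg l k1 x01 yU zl.
  have o1 : 1 <= offset sg l k1 x.
    apply: (@lim_le _ U _ (fun=> 1) (fun n => offset sg l k1 (y n))); [exact: cvg_cst|exact: lo|].
    by apply: filterE => n; have [_ _ h _ _] := Pry n.
  have o2 : offset sg l k1 x <= offset sg l k1 0 - eta * x.
    apply: (@lim_le _ U _ (fun n => offset sg l k1 (y n)) (fun n => offset sg l k1 0 - eta * y n)).
    - exact: lo.
    - apply: cvgB; [exact: cvg_cst|apply: cvgM; [exact: cvg_cst|exact: yU]].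
    - by apply: filterE => n; have [_ _ _ h _] := Pry n.
  split=> //.
    (* Failure of strictness at [x] makes [x] the parameter that [no] excludes: all earlier orbits
       are [sgood] and their limit is [wgood]. *)
    apply: contrapT => ns; apply: no; exists x; split=> //.
    - by rewrite x0.
    - by move=> g /below[].
    - by exists (k0 + N.-1)%N.
  apply: (foot_interior (sg := sg)) => //.
    apply/andP; split; first exact: lt_le_trans ltr01 o1.
    by apply: le_lt_trans off0l; apply: (le_trans o2); rewrite gerBl mulr_ge0 // ltW.
  apply/andP; split.
    apply: (@lim_le _ U _ (fun=> 0) (fun n => foot l k1 (y n))); [exact: cvg_cst|exact: lf|].
    by apply: filterE => n; have [_ _ _ _ /andP[h _]] := Pry n; exact: ltW.
  apply: (lim_le lf ls).
  by apply: filterE => n; have [_ _ _ _ /andP[_ h]] := Pry n; exact: ltW.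
have Popen (x : R) : 0 <= x < g1 -> Pr x -> forall y : nat -> R, (forall n, x < y n <= g1) ->
     y @ \oo --> x -> exists n, Pr (y n).
  move=> /andP[x0 xg1] [gx nx o1 o2 fx] y yx yoo.
  have yU : y @ U --> x by exact: (@ulim_eventually _ U).
  have x01 : 0 <= x <= ell by rewrite x0 /= (le_trans (ltW xg1)).
  have y01 n : 0 <= y n <= ell.
    by have /andP[h1 h2] := yx n; rewrite (le_trans x0 (ltW h1)) (le_trans h2).
  have vx := neq x (Q x) x01 (Qmin x) (near_sum x (Q x) (ltW xg1) nx).
  have Qc := orbit_cvg UU x01 y01 yU (sgood_wgood gx) vx.
  have Usg : U [set n | sgood (y n) (Q (y n))] by apply: (sgood_open UU x01 y01 yU Qc).
  have [lo lf ls] := cvg_foot_offset UU sg l k1 x01 yU Qc.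
  have /andP[fx0 fx1] := fx.
  have Ufoot : U [set n | 0 < foot l k1 (y n) < enorm (step (Q (y n)) k1)].
    have ld : enorm (step (Q (y n)) k1) - foot l k1 (y n) @[n --> U] -->
       enorm (step (Q x) k1) - foot l k1 x by exact: cvgB.
    have ld0 : 0 < enorm (step (Q x) k1) - foot l k1 x by rewrite subr_gt0.
    apply: filterS (ultraI UU (cvg_gt lf fx0) (cvg_gt ld ld0)) => n [/= ->].
    by rewrite subr_gt0.
  have Uoff1 : U [set n | 1 <= offset sg l k1 (y n)].
    apply: filterS (ultraI UU Usg (ultraI UU Ufoot (cvg_gt lo (lt_le_trans ltr01 o1)))).
    move=> n [/= h1 [/andP[h2 h3] h4]]; apply: offset_ge1 => //; first exact: sgood_wgood.
    - by rewrite !ltW.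
    - exact: ltW.
  have Uc k : U [set n | enorm (Q (y n) k - ctr (y n) k) = 1].
    by apply: filterS Usg => n [so _]; case: (so k).
  have ekn0 (i : nat) : (0 < i < N)%N -> ek (k0 + i)%N = 0.
    by move=> /skn0/eqP h; rewrite /ek (negbTE h).
  have ek0 : ek k0 = e by rewrite /ek sk0 eqxx.
  have P0p : periodic_lift N w (fun k => c (s k) + lk k).
    by move=> k; rewrite s_per lk_per addrA.
  have Ps g : 0 <= g <= g1 -> spaced ell (ctr g) by move=> /ein; exact: ctr_spaced.
  have x0g : 0 <= x <= g1 by rewrite x0 ltW.
  have [M [mu [A [M0 [mu0 ymu] DA DV [B1 B2 B3]]]]] := linearization N1 ell0 P0p ek_per ek0 ekn0 e1
    Ps Qmin UU x0g gx.1 yx yU Uc Qc (near_sum x (Q x) (ltW xg1) nx).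
  set v := velocity (Q x) in DV B1 B2 B3.
  have sp k := step_gt0 ell0 (ctr_spaced x01) (Qmin x) k.
  have spl k : ell <= enorm (step (Q x) k) by exact: feasible_step (ctr_spaced x01) (Qmin x).1.
  have v1 k : enorm (v k) = 1 := enorm_velocity ell0 (ctr_spaced x01) (Qmin x) k.
  have v01 k : enorm (v0 k) = 1.
    by apply: (enorm_velocity ell0 (ctr_spaced _) (Qmin 0)); rewrite lexx ltW.
  have M0n n : M n != 0 by rewrite gt_eqF.
  have mul : mu / (1 + ell) <= mu.
    by rewrite ler_pdivrMr ?addr_gt0 // ler_pMr // lerDl ltW.
  have turning k : tracked k -> `|dot (perp (v k)) (A k.+1 - A k)| <= 2 * mu.
    move=> kt; rewrite dotBr; apply: (le_trans (ler_normB _ _)).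
    suff [h1 h2] : `|dot (perp (v k)) (A k.+1)| <= mu /\ `|dot (perp (v k)) (A k)| <= mu by lra.
    case: kt => ->.
    - split=> //; have [] := B3 1%N; first by rewrite N1.
      by rewrite addn1 /= => _ h; exact: le_trans h mul.
    - split; first by rewrite NE.
      by have [|h _] := B3 N.-1; [rewrite -ltnS prednK // N1 /=|exact: le_trans h mul].
    - have [|h1 _] := B3 i1; first by rewrite i10 ltnW.
      have [|_ h2] := B3 i1.+1; first by rewrite i1N.
      by rewrite addnS /= in h2; split; [exact: le_trans h2 mul|exact: le_trans h1 mul].
  (* If the bound failed along [U], the limit rate of rotation would be at least
     [K * mu = 3 * mu / ell], whereas [turning] allows only [2 * mu / ell]. *)
  have Unear k : tracked k -> U [set n | enorm (velocity (Q (y n)) k - v0 k) <= K * y n].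
    move=> kt; apply: contrapT => /(ultraC UU) UA.
    have : K * mu <= enorm ((dot (perp (v k)) (A k.+1 - A k) / enorm (step (Q x) k)) *: perp (v k)).
      apply: (@lim_le _ U _ (fun n => K * ((y n - x) / M n))
        (fun n => enorm ((M n)^-1 *: (velocity (Q (y n)) k - v k)))).
      - by apply: cvgM; [exact: cvg_cst|exact: ymu].
      - by apply: cvg_enorm; exact: DV.
      - apply: filterS UA => n /= /negP; rewrite -ltNge => h.
        rewrite enormZ gtr0_norm ?invr_gt0 // mulrA mulrC ler_pM2l ?invr_gt0 //.
        have := nx k kt; have := enormD (velocity (Q (y n)) k - v k) (v k - v0 k).
        rewrite (_ : _ - _ + _ = velocity (Q (y n)) k - v0 k); last by vecring.
        by move=> h1 h2; rewrite /v in h1 *; lra.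
    rewrite enormZ enorm_perp v1 mulr1 normrM (gtr0_norm (_ : 0 < _^-1)) ?invr_gt0 //.
    rewrite leNgt => /negP; apply.
    rewrite ltr_pdivrMr //; apply: (le_lt_trans (turning k kt)).
    apply: (@lt_le_trans _ _ (K * mu * ell)); last by rewrite ler_pM2l ?mulr_gt0.
    by rewrite KE -mulrA [mu * _]mulrC mulrA divfK ?gt_eqF //; lra.
  have Uoff2 : U [set n | offset sg l k1 (y n) <= offset sg l k1 0 - eta * y n].
    apply: contrapT => /(ultraC UU) UA.
    set r := cen x ord0 l - Q x k1.
    pose b := dot (perp (v k1)) (A k1.+1 - A k1) / enorm (step (Q x) k1).
    (* Product rule for [offset]: the first term is the relative motion of center and vertex, the
       second the rotation of the segment. *)
    have lim : sg * (dot (((y n - x) / M n) *: e - (M n)^-1 *: (Q (y n) k1 - Q x k1))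
          (perp (velocity (Q (y n)) k1)) +
        dot r (perp ((M n)^-1 *: (velocity (Q (y n)) k1 - v k1)))) @[n --> U] -->
      sg * (dot (mu *: e - A k1) (perp (v k1)) + dot r (perp (b *: perp (v k1)))).
      apply: cvgM; first exact: cvg_cst.
      apply: cvgD; apply: cvg_dot.
      - by apply: vcvgB; [apply: vcvgZ; [exact: ymu|exact: vcvg_cst]|exact: DA].
      - by apply: vcvg_perp; exact: cvg_velocity.
      - exact: vcvg_cst.
      - by apply: vcvg_perp; exact: DV.
    have low : - (eta * mu) <=
        sg * (dot (mu *: e - A k1) (perp (v k1)) + dot r (perp (b *: perp (v k1)))).
      apply: (@lim_le _ U _ (fun n => - (eta * ((y n - x) / M n))) _ _ _ _ lim).
        by apply: cvgN; apply: cvgM; [exact: cvg_cst|exact: ymu].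
      apply: filterS UA => n /= /negP; rewrite -ltNge => h.
      have -> : sg * (dot (((y n - x) / M n) *: e - (M n)^-1 *: (Q (y n) k1 - Q x k1))
          (perp (velocity (Q (y n)) k1)) +
        dot r (perp ((M n)^-1 *: (velocity (Q (y n)) k1 - v k1)))) =
        (M n)^-1 * (offset sg l k1 (y n) - offset sg l k1 x).
        by rewrite /offset /r /cen eqxx /v; vring.
      have -> : - (eta * ((y n - x) / M n)) = (M n)^-1 * - (eta * (y n - x)) by ring.
      by rewrite ler_pM2l ?invr_gt0 //; move: o2 h; lra.
    have jb : b * enorm (step (Q x) k1) = dot (perp (v k1)) (A k1.+1) - dot (perp (v k1)) (A k1).
      by rewrite /b divfK ?gt_eqF // dotBr.
    have E : sg * (dot (mu *: e - A k1) (perp (v k1)) + dot r (perp (b *: perp (v k1)))) =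
       - mu * dot (v0 k1) (v k1) - sg * (dot (perp (v k1)) (A k1) + b * foot l k1 x).
      have -> : sg * (dot (mu *: e - A k1) (perp (v k1)) + dot r (perp (b *: perp (v k1)))) =
        mu * (sg * dot e (perp (v k1))) - sg * (dot (perp (v k1)) (A k1) + b * dot r (v k1)).
        by vring.
      have sgd z : sg * (- sg * z) = - z by rewrite mulrA mulrN -expr2 sg1 mulN1r.
      by rewrite eE dot_perp sgd /foot -/r -/v; ring.
    have vv : 1 - K * x <= dot (v0 k1) (v k1).
      have -> : dot (v0 k1) (v k1) = dot (v0 k1) (v0 k1) - dot (v0 k1) (v0 k1 - v k1) by vring.
      rewrite -enorm_sq v01 expr1n lerD2l lerN2.
      apply: (le_trans (dot_le_enorm _ (v01 k1))); rewrite enorm_dist.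
      by apply: nx; constructor 3.
    have [|a1 _] := B3 i1; first by rewrite i10 ltnW.
    have [|_ a2] := B3 i1.+1; first by rewrite i1N.
    rewrite addnS /= -/k1 in a2; rewrite -/k1 in a1.
    (* [T] locates the foot on the segment. The normal displacement there interpolates those of the
       two ends, both away from scatterer 0, hence the bound [mu / (1 + ell)]. *)
    pose T := foot l k1 x / enorm (step (Q x) k1).
    have T0 : 0 <= T by rewrite divr_ge0 // ltW.
    have T1 : T <= 1 by rewrite ler_pdivrMr // mul1r ltW.
    have bf : b * foot l k1 x = T * (dot (perp (v k1)) (A k1.+1) - dot (perp (v k1)) (A k1)).
      by rewrite -jb /T; field; rewrite gt_eqF.
    have J : `|dot (perp (v k1)) (A k1) + b * foot l k1 x| <= mu / (1 + ell).
      by rewrite bf; apply: norm_interpolate => //; rewrite T0.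
    have sgn1 : `|sg| = 1 by exact: norm1_of_sqr.
    have J2 : - (sg * (dot (perp (v k1)) (A k1) + b * foot l k1 x)) <= mu / (1 + ell).
      by apply: (le_trans (ler_norm _)); rewrite normrN normrM sgn1 mul1r.
    have Kx : K * x <= eta by apply: le_trans Kg1; rewrite ler_pM2l // ltW.
    have etaE2 : 1 / (1 + ell) = 1 - 3 * eta.
      by rewrite etaE; field; rewrite gt_eqF ?addr_gt0 //.
    have : mu / (1 + ell) = mu * (1 - 3 * eta) by rewrite -etaE2 mul1r.
    move=> h; move: low J2; rewrite E h => low J2.
    exact: (@approach_rate _ mu eta (K * x) _ _ mu0 eta0 Kx vv low J2).
  have UA : U [set n | Pr (y n)].
    have Un := ultraI UU (Unear k0 (Or31 _ _ erefl)) (ultraI UU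
      (Unear _ (Or32 _ _ erefl)) (Unear _ (Or33 _ _ erefl))).
    apply: filterS (ultraI UU Usg (ultraI UU Un (ultraI UU Uoff1 (ultraI UU Uoff2 Ufoot)))).
    move=> n [p1 [[p2 [p3 p4]] [p5 [p6 p7]]]]; split=> //.
    by move=> k [->|->|->].
  exact: (ultra_inh UU UA).
have := real_induction Pr0 Pclosed Popen (x := g1).
rewrite (ltW g10) lexx => /(_ isT)[_ _ h1 h2 _].
by move: off0g; rewrite -ltrBlDr ltNge (le_trans h1 h2).
Qed.

Lemma trajectory_wgood g x : (forall k, enorm (x k - ctr g k) = 1) ->
  (forall k, segment x k `<=` table X (moved g)) -> wgood g x.
Proof.
move=> xc tab.
have out k i l t : lattice X l -> 0 <= t <= 1 -> 1 <= enorm (x k + t *: step x k - cen g i l).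
  move=> hl t01; rewrite leNgt; apply/negP => h.
  apply: (tab k (x k + t *: step x k)); first by exists t.
  by exists i => //; exists (cen g i l) => //; exists l => //; rewrite movedE.
split=> [k|k i l hl _ _ t t01]; last exact: out.
split=> //.
  apply: outside_dot_ge0 => // t /andP[t0 t1].
  have := out k (s k) (lk k) t (lkl k); rewrite (ltW t0) t1 => /(_ isT).
  by rewrite -ctrE [x k + _ - _]addrAC.
rewrite -oppr_ge0 -dotNl; apply: outside_dot_ge0 => // t /andP[t0 t1].
have := out k (s k.+1) (lk k.+1) (1 - t) (lkl k.+1).
rewrite subr_ge0 t1 gerBl (ltW t0) => /(_ isT).
rewrite -ctrE (_ : x k + (1 - t) *: step x k - _ = x k.+1 - ctr g k.+1 + t *: - step x k) //.
by rewrite /step; vecring.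
Qed.

(** The converse of [wgood_trajectory]: outsideness makes the reflection coefficients [lam k]
    nonnegative, so the convexity inequality [len_ge] applies to the given orbit. *)
Lemma trajectory_minimizer g x : 0 <= g <= ell -> periodic_lift N w x ->
  (forall k, enorm (x k - ctr g k) = 1) -> wgood g x ->
  (forall k, velocity x k.+1 = specular (x k.+1 - ctr g k.+1) (velocity x k)) ->
  minimizer N w (ctr g) x.
Proof.
move=> g01 xp xc [wo _] spec; have Ps := ctr_spaced g01.
have fx : feasible N w (ctr g) x by split=> // k; rewrite xc.
have sp k : 0 < enorm (step x k) by exact: lt_le_trans ell0 (feasible_step k Ps fx).
split=> // z fz; pose lam k := - (2 * dot (velocity x k) (x k.+1 - ctr g k.+1)).
have lam0 k : 0 <= lam k.
  rewrite oppr_ge0 pmulr_rle0 // velocityE dot_udir pmulr_lle0 ?invr_gt0 //.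
  by case: (wo k).
have refl k : velocity x k.+1 - velocity x k = lam k *: (x k.+1 - ctr g k.+1).
  by rewrite spec /specular /lam scaleNr addrAC subrr add0r.
apply: le_trans (len_ge ell0 Ps fx fz refl lam0 xc); rewrite lerDl.
apply: sumr_ge0 => k _; apply: addr_ge0.
  by rewrite subr_ge0 velocityE; apply: dot_le_enorm; exact: enorm_udir.
by rewrite mulr_ge0 // divr_ge0 // dot_ge0.
Qed.

Lemma singular_perturbation_intro (x eps : R) (q : nat -> plane R) :
  0 < x <= ell -> x <= eps -> (forall k, Q 0 k = q k) ->
  (forall g, 0 <= g < x -> sgood g (Q g)) -> wgood x (Q x) -> ~ sgood x (Q x) ->
  (exists k, velocity (Q x) k.+1 != velocity (Q x) k) ->
  singular_perturbation X c N s q eps.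
Proof.
move=> /andP[x0 xl] xe Q0 below wx nsx vx.
have ein g : 0 <= g <= x -> 0 <= g <= ell by move=> /andP[-> h]; exact: le_trans h xl.
have weak g : 0 <= g <= x -> wgood g (Q g).
  move=> /andP[g0 gx]; have [->//|gx'] := eqVneq g x.
  by apply/sgood_wgood/below; rewrite g0 lt_neqAle gx'.
have neq g : 0 <= g <= x -> exists k, velocity (Q g) k.+1 != velocity (Q g) k.
  move=> /[dup] /ein gl /andP[g0 gx]; have [->//|gx'] := eqVneq g x.
  exists 0%N; apply: (outside_velocity_neq ell0 (ctr_spaced gl) (Qmin g)).
  by have [] := below g; rewrite ?g0 // lt_neqAle gx'.
exists x, (fun g => c ord0 + g *: e), Q; split=> //.
- split=> [|k]; apply: within_continuous_ultra => U UU g y g01 y01 yg.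
    by apply: vcvgD; [exact: vcvg_cst|apply: vcvgZ => //; exact: vcvg_cst].
  have [k0 vk0] := neq g g01.
  by apply: (orbit_cvg UU (ein g g01) (fun n => ein _ (y01 n)) yg (weak g g01) vk0).
- by rewrite scale0r addr0.
- move=> g g01; have gl := ein g g01; split.
  + exact: moved_system.
  + rewrite (_ : _ - _ = g *: e); last by vecring.
    have /andP[g0 gx] := g01.
    by rewrite enormZ e1 mulr1 ger0_norm // (le_trans gx).
  + exact: wgood_trajectory (Qmin g) (weak g g01).
  + move=> gx; apply: sgood_listed; apply: below.
    by rewrite gx andbT; case/andP: g01.
- apply: contrapT => ns; apply: nsx.
  by apply: wgood_singular ns => //; rewrite ltW.
Qed.

End Motion.

(** * The theorem *)

Section Angle.
Context {R : realType}.

(** With [t = sin (pi / 6)], the triple angle formula at [pi / 2] reads [3t - 4t^3 = 1], that is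
    [(t + 1)(2t - 1)^2 = 0]. *)
Lemma sin_pi6 : sin (pi / 6) = 1 / 2 :> R.
Proof.
have pi0 : 0 < pi :> R := pi_gt0 R.
pose x : R := pi / 6; rewrite -/x; set t := sin x; pose u := cos x.
have t0 : 0 < t by apply: sin_gt0_pihalf; rewrite /x; apply/andP; split; lra.
have u2 : u ^+ 2 = 1 - t ^+ 2 by have := cos2Dsin2 x; rewrite -/t -/u => <-; ring.
have h3 : sin (pi / 2) = 3 * t - 4 * t ^+ 3.
  rewrite (_ : pi / 2 = x *+ 2 + x); last by rewrite /x -mulr_natr; field.
  rewrite sinD sin_mulr2n cos_mulr2n -/t -/u.
  rewrite [LHS](_ : _ = 2 * u ^+ 2 * t + (2 * u ^+ 2 - 1) * t); last by ring.
  by rewrite u2; ring.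
have h : 3 * t - 4 * t ^+ 3 = 1 by rewrite -h3 sin_pihalf.
have : (t + 1) * (2 * t - 1) ^+ 2 = 0.
  have -> : (t + 1) * (2 * t - 1) ^+ 2 = 1 - (3 * t - 4 * t ^+ 3) by ring.
  by rewrite h subrr.
move=> /eqP; rewrite mulf_eq0 (gt_eqF (_ : 0 < t + 1)) /=; last by lra.
by rewrite sqrf_eq0 => /eqP ?; lra.
Qed.

Lemma sin_lt_half (alpha : R) : - (pi / 6) < alpha < pi / 6 -> 2 * `|sin alpha| < 1.
Proof.
move=> /andP[a0 a1]; have pi0 : 0 < pi :> R := pi_gt0 R.
have h1 : sin alpha < sin (pi / 6) by rewrite ltr_sin // !in_itv /=; apply/andP; split; lra.
have h2 : sin (- (pi / 6)) < sin alpha by rewrite ltr_sin // !in_itv /=; apply/andP; split; lra.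
rewrite sinN sin_pi6 in h2; rewrite sin_pi6 in h1.
suff : `|sin alpha| < 1 / 2 by lra.
by rewrite ltr_norml; apply/andP; split; lra.
Qed.

(** In the sum the normal components cancel, and the equal tangential components, of size
    [|sin alpha|], add up. *)
Lemma incidence_sum (n v : plane R) (alpha : R) : enorm n = 1 -> incidence_angle n v alpha ->
  enorm (v + specular n v) = 2 * `|sin alpha|.
Proof.
move=> n1 [_ vE]; have vE' : v = - rotation alpha n by rewrite -vE opprK.
have nn : n.1 * n.1 + n.2 * n.2 = 1 by move/enorm_eq1: n1.
have -> : v + specular n v = (- 2 * sin alpha) *: perp n.
  have dv : dot v n = - cos alpha.
    rewrite vE' /rotation; transitivity (- cos alpha * (n.1 * n.1 + n.2 * n.2)); first by vring.
    by rewrite nn mulr1.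
  by rewrite /specular dv vE' /rotation; vecring.
by rewrite enormZ enorm_perp n1 mulr1 normrM normrN (ger0_norm (ler0n _ 2)).
Qed.

End Angle.

Section ConstantFamily.
Context {R : realType} (X : ambient R) (m : nat).

Lemma singular_perturbation_singular (c : 'I_m.+1 -> plane R) N s q (eps : R) : 0 <= eps ->
  billiard_system X c -> periodic_trajectory X c N s q -> all_collisions_listed X c q ->
  singular X c q -> singular_perturbation X c N s q eps.
Proof.
move=> eps0 bs tr li si.
have E : move_scatterer c ord0 (c ord0) = c.
  by apply/funext => j; rewrite /move_scatterer; case: eqP => [->|].
exists 1, (fun=> c ord0), (fun=> q); rewrite E; split=> //.
  by split=> [|k]; apply: continuous_subspaceT => x; exact: cvg_cst.
by move=> g _; split=> //; rewrite subrr enorm0.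
Qed.

End ConstantFamily.

Theorem theorem1 (R : realType) (X : ambient R) (m : nat)
    (c : 'I_m.+1 -> plane R) (alpha : R) :
  billiard_system X c ->
  - (pi / 6) < alpha < pi / 6 ->
  forall eps : R, 0 < eps ->
  exists delta : R, 0 < delta /\
    forall (N : nat) (s : nat -> 'I_m.+1) (q : nat -> plane R),
      periodic_trajectory X c N s q ->
      all_collisions_listed X c q ->
      (exists k, segment q k `&` closed_scatterer X c ord0 = set0 /\
         set_distance (segment q k) (scatterer_boundary X c ord0) < delta) ->
      (exists! k, (k < N)%N /\ s k = ord0) ->
      (forall k, s k.+1 = ord0 -> collision_angle X c s q k alpha) ->
      singular_perturbation X c N s q eps.
Proof.
move=> bs alphaP eps eps0.
have [d d0 gap'] := scatterer_gap bs.
pose ell := d / 2; have ell0 : 0 < ell by rewrite divr_gt0.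
have gap i j l l' : lattice X l -> lattice X l' -> (i, l) <> (j, l') ->
    2 + (ell + ell) <= enorm (c i + l - (c j + l')).
  by rewrite (_ : ell + ell = d); [exact: gap'|rewrite /ell; field].
have sa := sin_lt_half alphaP; set a2 := 2 * `|sin alpha| in sa.
pose K := 3 / ell; have K0 : 0 < K by rewrite divr_gt0.
pose eta := ell / (3 * (1 + ell)).
have eta0 : 0 < eta by rewrite divr_gt0 // mulr_gt0 // addr_gt0.
(* [eps] and [ell] limit the displacement, the latter to preserve half of every gap. [eta / K] keeps
   the direction of the nearby segment within [eta], and the last term spends the slack [1 - a2] on
   the two flights at scatterer 0. *)
pose g1 := Num.min (Num.min eps ell) (Num.min (eta / K) ((1 - a2) / (2 * K))).
have g10 : 0 < g1.
  rewrite !lt_min eps0 ell0 /=; apply/andP; split; first exact: divr_gt0.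
  by apply: divr_gt0; [rewrite subr_gt0|rewrite mulr_gt0].
have g1eps : g1 <= eps by rewrite !ge_min lexx.
have g1ell : g1 <= ell by rewrite !ge_min lexx orbT.
have Kg1 : K * g1 <= eta by rewrite mulrC -ler_pdivlMr // !ge_min lexx !orbT.
have Kg1' : a2 + 2 * K * g1 <= 1.
  have K20 : 0 < 2 * K by exact: mulr_gt0.
  rewrite -lerBrDl mulrC -ler_pdivlMr //.
  by rewrite !ge_min lexx !orbT.
(* Over the range [g1] the offset must shrink by [eta * g1], more than the initial distance. The
   bound [ell] places the foot of the perpendicular inside the segment. *)
exists (Num.min ell (eta * g1)); split; first by rewrite lt_min ell0 mulr_gt0.
move=> N s q tr li [k1' [k1dis k1dist]] [k0 [[k0N sk0] k0uniq]] ang.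
(* The hypotheses allow a grazing collision among the listed ones; such an orbit is
   already singular, and the constant family does the job. *)
have [si|nsi] := pselect (singular X c q).
  by apply: singular_perturbation_singular => //; exact: ltW.
have [N0 [w wl qw] s_per [bd ne tab spec]] := tr.
have lift_ex k : exists l, lattice X l /\ enorm (q k - (c (s k) + l)) = 1.
  by have [_ [l hl ->] h] := bd k; exists l.
have [lk lkP] := choice lift_ex.
have lkl k := (lkP k).1; have lkc k := (lkP k).2.
have uniq_lift i j l l' z : lattice X l -> lattice X l' ->
    enorm (z - (c i + l)) <= 1 -> enorm (z - (c j + l')) <= 1 -> (i, l) = (j, l').
  move=> hl hl' z1 z2; apply: contrapT => nij.
  have := gap i j l l' hl hl' nij; rewrite leNgt => /negP; apply.
  rewrite (_ : _ - _ = (z - (c j + l')) - (z - (c i + l))); last by vecring.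
  by apply: (le_lt_trans (enormB _ _)); lra.
have lk_per k : lk (k + N)%N = lk k + w.
  suff : (s k, lk (k + N)%N - w) = (s k, lk k).
    by move=> h; rewrite -(congr1 snd h : lk (k + N)%N - w = lk k) subrK.
  apply: (@uniq_lift _ _ _ _ (q k)); rewrite ?lkc //; first exact: latticeB.
  have := lkc (k + N)%N; rewrite qw s_per => h.
  by rewrite (_ : _ - _ = q k + w - (c (s k) + lk (k + N)%N)) ?h //; vecring.
(* Two successive collisions with the same lifted disk would span a chord, whose midpoint is in the
   open disk by the parallelogram law. *)
have adj k : (s k, lk k) <> (s k.+1, lk k.+1).
  move=> h; have h1 := lkc k; have h2 := lkc k.+1.
  have E : c (s k.+1) + lk k.+1 = c (s k) + lk k.
    by rewrite (congr1 fst h : s k = _) (congr1 snd h : lk k = _).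
  rewrite E in h2; set p := c (s k) + lk k in h1 h2.
  have /negP : ~ enorm (q k + 2^-1 *: (q k.+1 - q k) - p) < 1.
    move=> lt1; apply: (tab k (q k + 2^-1 *: (q k.+1 - q k))).
      by exists 2^-1; split=> //; rewrite invr_ge0 ler0n invf_le1 // ler1n.
    by exists (s k) => //; exists p => //; exists (lk k).
  rewrite -leNgt enorm_ge // expr1n => h3.
  have : dot (q k.+1 - q k) (q k.+1 - q k) <= 0.
    move: h1 h2 => /enorm_eq1 h1 /enorm_eq1 h2.
    have -> : dot (q k.+1 - q k) (q k.+1 - q k) = 2 * dot (q k - p) (q k - p) +
       2 * dot (q k.+1 - p) (q k.+1 - p) -
       4 * dot (q k + 2^-1 *: (q k.+1 - q k) - p) (q k + 2^-1 *: (q k.+1 - q k) - p).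
      by vec; field.
    by rewrite h1 h2; lra.
  rewrite -enorm_sq => h4; apply: (ne k); apply/esym/subr0_eq/enorm_eq0.
  by apply/eqP; rewrite -sqrf_eq0 eq_le h4 sqr_ge0.
have skn0 (i : nat) : (0 < i < N)%N -> s (k0 + i)%N <> ord0.
  move=> /andP[i0 iN] h; have [j jN E] := periodic_window 0 (k0 + i) N0.
  have sj : s j = ord0 by rewrite -h (E _ s s_per).
  have k0j := k0uniq j (conj jN sj).
  have := E _ (fun k => k %% N)%N (fun k => modnDr k N).
  rewrite add0n -k0j => /eqP; rewrite -{2}[k0]addn0 eqn_modDl !modn_small // => /eqP i00.
  by rewrite i00 in i0.
have angle_k0 := ang (k0 + N.-1)%N.
have NE : (k0 + N.-1).+1 = (k0 + N)%N by rewrite -addnS prednK.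
rewrite NE s_per in angle_k0; have {angle_k0} [p0 [p0l p0c inc]] := angle_k0 sk0.
have vel_per k : velocity q (k + N) = velocity q k by exact: velocity_per qw.
have specE := spec _ _ p0l p0c.
rewrite NE vel_per in specE; rewrite NE in p0c inc.
have vsum : enorm (velocity q k0 + velocity q (k0 + N.-1)) <= a2.
  by rewrite addrC specE (incidence_sum p0c inc).
(* With [N = 1] the velocities before and after scatterer 0 coincide and their sum has length 2,
   against [a2 < 1]. *)
have N1 : (1 < N)%N.
  rewrite ltn_neqAle N0 andbT; apply/eqP => N1'.
  have v1 : enorm (velocity q k0) = 1.
    rewrite velocityE enorm_udir // lt_neqAle enorm_ge0 andbT eq_sym.
    by apply/eqP => /enorm_eq0/subr0_eq/esym; exact: ne.
  move: vsum; rewrite -N1' addn0 (_ : _ + _ = 2 *: velocity q k0); last by vecring.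
  by rewrite enormZ v1 mulr1 ger0_norm // leNgt (lt_trans sa) // ltr1n.
have [i1 i1N Ewin] := periodic_window k0 k1' N0.
pose k1 := (k0 + i1)%N.
(* The nearby segment avoids the closed scatterer 0, so neither end lies on it. This puts the flight
   strictly between two visits: [0 < i1] and [i1.+1 < N]. *)
have disj k : q k \in segment q k1' -> s k = ord0 -> False.
  move=> /set_mem hseg sk; move: k1dis; rewrite -subset0 => /(_ (q k)); apply.
  split=> //; exists (c (s k) + lk k); first by exists (lk k) => //; rewrite sk.
  by rewrite /closed_disk /= lkc.
have sk1' : s k1' <> ord0.
  by apply: disj; apply/mem_set; exists 0; rewrite lexx ler01 scale0r addr0.
have sk1S' : s k1'.+1 <> ord0.
  apply: disj; apply/mem_set; exists 1; rewrite lexx ler01 scale1r; split=> //.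
  by rewrite addrC subrK.
have sk1 : s k1 <> ord0 by rewrite -(Ewin _ s s_per).
have sk1S : s k1.+1 <> ord0.
  by rewrite -(Ewin _ (fun k => s k.+1)) // => k; rewrite -addSn s_per.
have i10 : (0 < i1)%N.
  by rewrite lt0n; apply/eqP => i0; apply: sk1; rewrite /k1 i0 addn0.
have i1SN : (i1.+1 < N)%N.
  by rewrite ltn_neqAle i1N andbT; apply/eqP => h; apply: sk1S; rewrite /k1 -addnS h s_per.
(* Nearness is phrased as a periodic property of the index, with the period [l] left free, in order
   to move [k1'] into the window that starts at [k0]. *)
pose close k := exists l t, [/\ lattice X l, 0 <= t <= 1 &
  enorm (q k + t *: step q k - (c ord0 + l)) < 1 + Num.min ell (eta * g1)].
have close_per k : close (k + N)%N = close k.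
  have qE t : q (k + N)%N + t *: step q (k + N) = q k + t *: step q k + w.
    by rewrite qw (step_per k qw); vecring.
  apply: propext; split=> -[l [t [hl t01 h]]].
    exists (l - w), t; split=> //; first exact: latticeB.
    by move: h; rewrite qE; apply: le_lt_trans; rewrite le_eqVlt; apply/orP; left; apply/eqP;
       congr enorm; vecring.
  exists (l + w), t; split=> //; first exact: latticeD.
  move: h; rewrite qE; apply: le_lt_trans; rewrite le_eqVlt; apply/orP; left; apply/eqP.
  by congr enorm; vecring.
have [l [t [hl t01 near]]] : close k1.
  rewrite -(Ewin _ close close_per).
  set S := [set d' | exists x y, [/\ segment q k1' x, scatterer_boundary X c ord0 y &
    d' = enorm (x - y)]] in k1dist.
  have hS : has_inf S.
    split; last by exists 0 => _ [x [y [_ _ ->]]]; exact: enorm_ge0.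
    exists (enorm (q k1' - (c ord0 + (1, 0)))), (q k1'), (c ord0 + (1, 0)); split=> //.
      by exists 0; rewrite lexx ler01 scale0r addr0.
    exists (c ord0); first by exists 0; [exact: lattice0|rewrite addr0].
    by rewrite /circle /= addrAC subrr add0r; apply/enorm_eq1; vec; ring.
  have gap0 : 0 < Num.min ell (eta * g1) - inf S by rewrite subr_gt0.
  have [_ [x [y [[t [t01 xE]] [_ [l hl ->] yc] ->]]]] := inf_adherent gap0 hS.
  rewrite [inf S + _]addrC subrK => xy; exists l, t; split=> //.
  rewrite -xE (_ : x - _ = (x - y) + (y - (c ord0 + l))); last by vecring.
  apply: (le_lt_trans (enormD _ _)); rewrite (yc : enorm _ = 1) addrC.
  by rewrite ltrD2l.
pose v := velocity q k1.
(* The side of the segment on which scatterer 0 lies: [offset] then starts nonnegative, and [e]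
   points from the center towards the line of the segment. *)
pose sg : R := if 0 <= dot (c ord0 + l - q k1) (perp v) then 1 else -1.
have sg1 : sg ^+ 2 = 1 by rewrite /sg; case: ifP; rewrite ?sqrrN expr1n.
pose e := - sg *: perp v.
have sp k : 0 < enorm (step q k).
  by rewrite lt_neqAle enorm_ge0 andbT eq_sym; apply/eqP => /enorm_eq0/subr0_eq/esym; exact: ne.
have e1 : enorm e = 1.
  by rewrite enormZ normrN (norm1_of_sqr sg1) mul1r enorm_perp /v velocityE enorm_udir.
have ctr0 k : ctr c e s lk 0 k = c (s k) + lk k by rewrite /ctr scale0r addr0.
have cen0 i l' : cen c e 0 i l' = c i + l' by rewrite /cen; case: ifP => _; rewrite scale0r addr0.
have moved0 : moved c e 0 = c.
  by apply/funext => j; rewrite -[LHS]addr0 movedE cen0 addr0.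
have z0 : (0 : R) <= 0 <= ell by apply/andP; split; [exact: lexx|exact: ltW].
have qc k : enorm (q k - ctr c e s lk 0 k) = 1 by rewrite ctr0.
have wq : wgood X c e s lk 0 q by apply: (trajectory_wgood lkl qc); rewrite moved0.
have qmin : minimizer N w (ctr c e s lk 0) q.
  apply: (trajectory_minimizer ell0 gap lkl adj e1 z0 qw qc wq) => k.
  rewrite ctr0; apply: spec; last exact: lkc.
  by exists (lk k.+1).
have gq : sgood X c e s lk 0 q.
  by apply: (wgood_singular ell0 gap lkl adj e1 z0 qmin wq); rewrite moved0.
have [Q Qmin] := choice (fun g => minimizer_exists (ctr_per c e s_per lk_per g)).
have Ps := ctr_spaced ell0 gap lkl adj e1 z0.
have Q0 k : Q 0 k = q k.
  apply: (minimizer_unique' N1 ell0 (ctr_per c e s_per lk_per 0) Ps qmin _ wq.1 (Qmin 0)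
    (k := 0%N)).
  exact: outside_velocity_neq ell0 Ps qmin 0%N gq.1.
have Q0E : Q 0 = q by apply/funext.
have offset_near := offset_le ell0 gap lkl adj e1 Qmin l k1 t z0 sg1.
rewrite Q0E cen0 in offset_near.
have off_lt := le_lt_trans offset_near near.
have offl : offset c e Q sg l k1 0 < 1 + ell.
  by apply: (lt_le_trans off_lt); rewrite lerD2l ge_min lexx.
have foot01 : 0 <= foot c e Q l k1 0 <= enorm (step (Q 0) k1).
  apply: (foot_between ell0 gap lkl adj e1 Qmin z0 hl sk1 sk1S t01).
  by rewrite Q0E cen0; apply: (lt_le_trans near); rewrite lerD2l ge_min lexx.
have off0 : 0 <= offset c e Q sg l k1 0.
  rewrite /offset Q0E cen0 /sg -/v; case: ifPn => [?|]; first by rewrite mul1r.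
  by rewrite -ltNge mulN1r oppr_ge0; exact: ltW.
have off1 : 1 <= offset c e Q sg l k1 0.
  by apply: (offset_ge1 ell0 gap lkl adj e1 Qmin z0 sg1 hl _ foot01 off0); rewrite Q0E.
have foot01' : 0 < foot c e Q l k1 0 < enorm (step (Q 0) k1).
  apply: (foot_interior ell0 gap lkl adj e1 Qmin z0 sg1 hl sk1 sk1S _ foot01).
  by rewrite (lt_le_trans ltr01 off1).
have [x [x01 below wx nsx vx]] : exists x : R, [/\ 0 < x <= g1,
    forall g, 0 <= g < x -> sgood X c e s lk g (Q g),
    wgood X c e s lk x (Q x), ~ sgood X c e s lk x (Q x) &
    exists k, velocity (Q x) k.+1 != velocity (Q x) k].
  apply: (reach_singular bs ell0 gap N1 wl s_per lkl lk_per adj e1 Qmin sk0 skn0 hl i10 i1SN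
    sg1 _ _ (erefl K) (erefl eta)) => //.
  - by rewrite Q0E.
  - by rewrite g10.
  - by rewrite Q0E; apply: le_trans Kg1'; rewrite lerD2r.
  - by rewrite Q0E.
  - by apply: (lt_le_trans off_lt); rewrite lerD2l ge_min lexx orbT.
have /andP[x0 xg1] := x01.
apply: (singular_perturbation_intro bs ell0 gap N1 wl s_per lkl lk_per adj e1 Qmin
  _ _ Q0 below wx nsx vx); last exact: le_trans xg1 g1eps.
by rewrite x0 (le_trans xg1).
Qed.
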